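(* There is a randomized algorithm which, given a weighted oriented graph $D=(V,A,w)$ with $n=|V|$ vertices, $a(D)=|A|$ arcs and maximum degree $\Delta=\Delta(D)\ge1$, runs in time $O(a(D)+n\log n)$ and outputs a (random) ordering $\sigma$ of $V$ such that $$\mathbb{E}\bigl[w(\mathrm{fwd}(\sigma))-w(\mathrm{back}(\sigma))\bigr]\;\ge\;\frac{\sqrt2}{6}\sum_{v\in V}w_2(v)\;\ge\;\frac{\sqrt2\,w(D)}{3\sqrt{\Delta}},$$ and hence whose set of backward arcs is a feedback arc set of $D$ satisfying $$\mathbb{E}\bigl[w(\mathrm{back}(\sigma))\bigr]\;\le\;\frac{w(D)}{2}-\frac{\sqrt2}{12}\sum_{v\in V}w_2(v)\;\le\;\Bigl(\frac12-\frac{\sqrt2}{6\sqrt{\Delta}}\Bigr)w(D).$$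
   Context: All digraphs are finite. An oriented graph is a digraph $D=(V,A)$ with no loops and no directed $2$-cycles. A weighted oriented graph is an oriented graph with a function $w\colon A\to\mathbb{R}_{\ge0}$; for $S\subseteq A$, $w(S)=\sum_{e\in S}w(e)$, and $w(D)=w(A)$. The degree of $v$ is out-degree plus in-degree, and $\Delta(D)$ is the maximum degree. For $v\in V$, $w_2(v)=\bigl(\sum_{e\ni v}w(e)^2\bigr)^{1/2}$, the sum being over all arcs incident with $v$. A feedback arc set is a set $F\subseteq A$ such that $D-F$ is acyclic. For an ordering $\sigma=v_1\cdots v_n$ of $V$, an arc from $v_i$ to $v_j$ is forward if $i<j$ and backward if $i>j$; $\mathrm{fwd}(\sigma)$ and $\mathrm{back}(\sigma)$ are the sets of forward and backward arcs. Computation model: the graph is given by adjacency lists; arithmetic operations and comparisons on real numbers, and sampling an independent uniform $[0,1]$ random number, each take unit time. *)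

(* Defs.v *)
From HB Require Import structures.
From mathcomp Require Import all_boot all_order all_algebra.
From mathcomp Require Import all_classical all_reals all_analysis.

Set Implicit Arguments.
Unset Strict Implicit.
Unset Printing Implicit Defensive.

Import Order.TTheory GRing.Theory Num.Theory.

Local Open Scope classical_set_scope.
Local Open Scope ring_scope.

(** * Weighted oriented graphs *)

(* Only the values of [weight] on [arcs] are meaningful. *)
Record wograph (R : realType) (V : finType) := WOGraph {
  arcs : {set V * V};
  weight : V * V -> R;
  arcs_loopless : forall v, (v, v) \notin arcs;
  arcs_oriented : forall u v, (u, v) \in arcs -> (v, u) \notin arcs;
  weight_ge0 : forall e, e \in arcs -> 0 <= weight e
}.

Section Graphs.
Context {R : realType} {V : finType}.
Implicit Types (D : wograph R V) (F S : {set V * V}) (v : V) (s : seq V).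

Definition wsum D S : R := \sum_(e in S) weight D e.

Definition degree D v : nat :=
  (#|[set e in arcs D | e.1 == v]| + #|[set e in arcs D | e.2 == v]|)%N.

Definition maxdeg D : nat := \max_(v : V) degree D v.

Definition incident (e : V * V) v : bool := (e.1 == v) || (e.2 == v).

Definition w2 D v : R :=
  Num.sqrt (\sum_(e in arcs D | incident e v) weight D e ^+ 2).

Definition acyclic F : Prop :=
  forall p : seq V, ucycle (fun u v => (u, v) \in F) p -> p = [::].

Definition feedback_arc_set D F : Prop :=
  F \subset arcs D /\ acyclic (arcs D :\: F).

Definition is_ordering s : Prop := uniq s /\ forall v, v \in s.

Definition fwd D s : {set V * V} :=
  [set e in arcs D | (index e.1 s < index e.2 s)%N].

Definition back D s : {set V * V} :=
  [set e in arcs D | (index e.2 s < index e.1 s)%N].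

End Graphs.

(** * Randomized real RAM

   A program uses finitely many integer and real variables and finitely many
   unbounded integer and real arrays, all named by natural numbers.  Every
   operator, constant, variable or array access, assignment, test and random
   draw costs one unit of time.  Integers (used for control and addressing) only
   support addition, truncated subtraction and comparison.  Information flows
   from reals to integers only through comparisons: there is no rounding
   operation. *)

Inductive iexp : Type :=
| IConst of nat
| IVar of nat
| IGet of nat & iexp
| IAdd of iexp & iexp
| ISub of iexp & iexp.

Inductive rexp : Type :=
| RConst of nat
| RVar of nat
| RGet of nat & iexp
| RAdd of rexp & rexp
| RSub of rexp & rexp
| RMul of rexp & rexp
| RDiv of rexp & rexp.

Inductive bexp : Type :=
| ILe of iexp & iexp
| RLe of rexp & rexp
| BNot of bexp
| BAnd of bexp & bexp.

(* [ISet x e] is x := e, [IPut a i e] is a[i] := e; [Sample x] stores a fresh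
   uniform random number in the real variable x. *)
Inductive cmd : Type :=
| Skip
| ISet of nat & iexp
| IPut of nat & iexp & iexp
| RSet of nat & rexp
| RPut of nat & iexp & rexp
| Sample of nat
| Seq of cmd & cmd
| If of bexp & cmd & cmd
| While of bexp & cmd.

Fixpoint icost (e : iexp) : nat :=
  match e with
  | IConst _ | IVar _ => 1
  | IGet _ e1 => (icost e1).+1
  | IAdd e1 e2 | ISub e1 e2 => (icost e1 + icost e2).+1
  end.

Fixpoint rcost (e : rexp) : nat :=
  match e with
  | RConst _ | RVar _ => 1
  | RGet _ i => (icost i).+1
  | RAdd e1 e2 | RSub e1 e2 | RMul e1 e2 | RDiv e1 e2 =>
      (rcost e1 + rcost e2).+1
  end.

Fixpoint bcost (b : bexp) : nat :=
  match b with
  | ILe e1 e2 => (icost e1 + icost e2).+1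
  | RLe e1 e2 => (rcost e1 + rcost e2).+1
  | BNot b1 => (bcost b1).+1
  | BAnd b1 b2 => (bcost b1 + bcost b2).+1
  end.

(* [drawn] counts the random numbers consumed so far. *)
Record state (R : realType) := State {
  ivar : nat -> nat;
  rvar : nat -> R;
  iarr : nat -> nat -> nat;
  rarr : nat -> nat -> R;
  drawn : nat
}.

Section Semantics.
Context {R : realType}.
Implicit Types (st : state R).

Fixpoint ieval st (e : iexp) : nat :=
  match e with
  | IConst c => c
  | IVar x => ivar st x
  | IGet a e1 => iarr st a (ieval st e1)
  | IAdd e1 e2 => (ieval st e1 + ieval st e2)%N
  | ISub e1 e2 => (ieval st e1 - ieval st e2)%N
  end.

Fixpoint reval st (e : rexp) : R :=
  match e with
  | RConst c => c%:R
  | RVar x => rvar st x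
  | RGet a i => rarr st a (ieval st i)
  | RAdd e1 e2 => reval st e1 + reval st e2
  | RSub e1 e2 => reval st e1 - reval st e2
  | RMul e1 e2 => reval st e1 * reval st e2
  | RDiv e1 e2 => reval st e1 / reval st e2
  end.

Fixpoint beval st (b : bexp) : bool :=
  match b with
  | ILe e1 e2 => (ieval st e1 <= ieval st e2)%N
  | RLe e1 e2 => reval st e1 <= reval st e2
  | BNot b1 => ~~ beval st b1
  | BAnd b1 b2 => beval st b1 && beval st b2
  end.

Definition upd (T : Type) (f : nat -> T) (i : nat) (x : T) : nat -> T :=
  fun j => if j == i then x else f j.

Definition iset st x k : state R :=
  State (upd (ivar st) x k) (rvar st) (iarr st) (rarr st) (drawn st).

Definition rset st x r : state R :=
  State (ivar st) (upd (rvar st) x r) (iarr st) (rarr st) (drawn st).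

Definition iput st a i k : state R :=
  State (ivar st) (rvar st) (upd (iarr st) a (upd (iarr st a) i k)) (rarr st)
        (drawn st).

Definition rput st a i r : state R :=
  State (ivar st) (rvar st) (iarr st) (upd (rarr st) a (upd (rarr st a) i r))
        (drawn st).

Definition draw (u : nat -> R) st x : state R :=
  State (ivar st) (upd (rvar st) x (u (drawn st))) (iarr st) (rarr st)
        (drawn st).+1.

(* [exec u c st t st']: when the successive random draws return
   u 0, u 1, ..., running c from st halts in st' after t units of time. *)
Inductive exec (u : nat -> R) : cmd -> state R -> nat -> state R -> Prop :=
| exec_skip st : exec u Skip st 1 st
| exec_iset st x e :
    exec u (ISet x e) st (icost e).+1 (iset st x (ieval st e))
| exec_iput st a i e :
    exec u (IPut a i e) st (icost i + icost e).+1
         (iput st a (ieval st i) (ieval st e))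
| exec_rset st x e :
    exec u (RSet x e) st (rcost e).+1 (rset st x (reval st e))
| exec_rput st a i e :
    exec u (RPut a i e) st (icost i + rcost e).+1
         (rput st a (ieval st i) (reval st e))
| exec_sample st x : exec u (Sample x) st 1 (draw u st x)
| exec_seq c1 c2 st st1 st2 t1 t2 :
    exec u c1 st t1 st1 -> exec u c2 st1 t2 st2 ->
    exec u (Seq c1 c2) st (t1 + t2)%N st2
| exec_if b c1 c2 st st1 t :
    exec u (if beval st b then c1 else c2) st t st1 ->
    exec u (If b c1 c2) st ((bcost b).+1 + t)%N st1
| exec_while_stop b c st :
    ~~ beval st b -> exec u (While b c) st (bcost b).+1 st
| exec_while_step b c st st1 st2 t1 t2 :
    beval st b -> exec u c st t1 st1 -> exec u (While b c) st1 t2 st2 ->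
    exec u (While b c) st ((bcost b).+1 + (t1 + t2))%N st2.

End Semantics.

(** * Input and output conventions *)

(* Integer variable 0 holds the number n of vertices, which are 0, ..., n-1.
   Integer arrays 0, 1, 2 are [head] (indexed by vertices), [next] and [target]
   (indexed by list cells) and real array 0 is [cell weight].  Address 0 is the
   null pointer.  The list of a vertex v runs through the arcs leaving v, in any
   order.  The output is read in integer array 3. *)

Section InputOutput.
Context {R : realType} {n : nat}.

Fixpoint linked_list (st : state R) (p : nat) (l : seq (nat * R)) : Prop :=
  match l with
  | [::] => p = 0%N
  | (x, r) :: l1 =>
      [/\ p <> 0%N, iarr st 2 p = x, rarr st 0 p = r
        & linked_list st (iarr st 1 p) l1]
  end.

(* The remaining memory is arbitrary. *)
Definition input_state (D : wograph R 'I_n) (st : state R) : Prop :=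
  [/\ ivar st 0 = n, drawn st = 0%N &
      forall v : 'I_n, exists l : seq 'I_n,
        [/\ uniq l, forall x, (x \in l) = ((v, x) \in arcs D) &
            linked_list st (iarr st 0 v)
              [seq (val x, weight D (v, x)) | x <- l]]].

Definition output_is (st : state R) (s : seq 'I_n) : Prop :=
  [seq iarr st 3 i | i <- iota 0 n] = [seq val v | v <- s].

Definition computes_within (u : nat -> R) (prog : cmd) (st : state R)
    (T : R) (s : seq 'I_n) : Prop :=
  exists t st', [/\ exec u prog st t st', t%:R <= T & output_is st' s].

End InputOutput.

(** * The source of randomness *)

(* Independent random variables with the uniform law on [0, 1] and values in
   [0, 1].  Independence is the product rule for every finite subfamily. *)
Definition iid_uniform01 {R : realType} {d : measure_display}
    {Omega : measurableType d} (P : probability Omega R)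
    (U : nat -> {RV P >-> R}) : Prop :=
  [/\ forall i omega, 0 <= U i omega <= 1,
      forall i (A : set R), measurable A ->
        distribution P (U i) A = uniform_prob (@ltr01 R) A
    & forall (s : seq nat) (A : nat -> set R),
        uniq s -> (forall i, measurable (A i)) ->
        P (\bigcap_(i in [set` s]) (U i @^-1` A i)) =
        (\prod_(i <- s) P (U i @^-1` A i))%E].

(* Main.v *)
Require Import Defs.
From HB Require Import structures.
From mathcomp Require Import all_boot all_order all_algebra.
From mathcomp Require Import ring lra zify.

Set Implicit Arguments.
Unset Strict Implicit.
Unset Printing Implicit Defensive.

Import Order.TTheory GRing.Theory Num.Theory.

Local Open Scope ring_scope.

(** Choose the vertices one by one in a uniformly random order.  Writing
    a(v, u) = w(v, u) - w(u, v), and r for the set of vertices that are not yet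
    chosen, the chosen vertex v is put before all of r or after all of r,
    according to the sign of the score, the sum of a(v, u) over u in r.  The
    final gain w(fwd) - w(back) is then the sum of the absolute values of all
    scores ([gain_arrange], [wsum_fwd_back]).

    Expected gain.  For a fixed v, the vertices chosen after v form a random
    subset T of Q = V - v whose size is uniform and which is uniform given its
    size.  Hence v contributes E|a(T)|, called [adaptive_gain] below, and it is
    enough to show that this is at least sqrt 2 / 6 times the Euclidean norm of
    a(v, .) on Q, which is w_2(v).  Averaging over T and its complement bounds
    E|a(T)| below by half of E|a(T) - a(Q - T)|, a signed sum whose signs are
    those of the first |Q| draws from a Polya urn.  With r = |Q|, the sign of a
    given u is a fresh fair coin with probability 2/(r+1), and otherwise is a
    copy of the sign of a uniformly random other element.  Exposing u thus
    either moves u to a set F of independent signs or merges u with another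
    element ([energy_rec]).  Starting from Khintchine's inequality with
    constant 1/sqrt 2 for independent signs, induction on r gives, for r >= 2,
      sqrt 2 * E|z_F + z_Q| >= sqrt (f + (4/9) (q + h S^2)),
    where f and q are the sums of squares over F and Q, S is the sum over Q and
    h = 1/2 + (4/9)/(r-1) ([energy_lower_bound]).  The induction step exposes
    an element u with |a_u| minimal, and is an inequality between square roots
    ([merge_step_normalized]).  The term h S^2 is what makes it close: merging
    adds 2 a_u a_j to q, and the sum of these over j is 2 a_u (S - a_u).

    Running time.  A single uniform real x encodes the random order.  If j is
    the integer part of k x, then j is uniform in 0, ..., k-1 and k x - j is
    again uniform; iterating this for k = n, n-1, ..., 1 reads off the digits
    of x in the factorial base, so that every order has probability 1/n!
    ([order_of_realE], [expectation_digit]).  The digits drive a Fisher-Yates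
    shuffle.  The machine cannot round, but a binary search in a table of the
    reals 0, ..., n finds j in O(log n) steps.  One pass over the adjacency
    lists then gives all scores, and one pass over the vertices gives the
    ordering ([program_correct]).

    The bounds in terms of the maximum degree follow from the Cauchy-Schwarz
    inequality at each vertex ([sum_w2_ge]). *)

(** * Lower bounds for square roots *)

Section RealIneq.
Variable R : rcfType.
Implicit Types (w x y a b p S m : R).

Lemma sqrt_ge x y : x ^+ 2 <= y -> x <= Num.sqrt y.
Proof.
move=> h; apply: le_trans (ler_norm x) _.
by rewrite -sqrtr_sqr ler_wsqrtr.
Qed.

(** For [w > 8] the left-hand side is negative. *)
Lemma sqrt_quad_pos w : 0 <= w -> 1 + w / 2 - w ^+ 2 / 8 <= Num.sqrt (1 + w).
Proof.
move=> w0.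
have [w8|w8] := leP w 8; last by apply: le_trans (sqrtr_ge0 _); nra.
apply: sqrt_ge.
have -> : (1 + w / 2 - w ^+ 2 / 8) ^+ 2 = 1 + w - w ^+ 3 * (8 - w) / 64 by field.
have : 0 <= w ^+ 3 * (8 - w) by apply: mulr_ge0; [apply: exprn_ge0|lra].
lra.
Qed.

Lemma sqrt_cubic w : - (18 / 25) <= w ->
  1 + w / 2 - w ^+ 2 / 8 - `|w| ^+ 3 / 8 <= Num.sqrt (1 + w).
Proof.
move=> hw.
have [w0|w0] := leP 0 w.
  apply: le_trans (sqrt_quad_pos w0).
  have : 0 <= `|w| ^+ 3 by apply: exprn_ge0.
  lra.
apply: sqrt_ge; rewrite ltr0_norm //.
have: exists t, t = - w by exists (- w).
case=> t ht; have -> : w = - t by rewrite ht opprK.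
have t0 : 0 < t by lra.
have t1 : t <= 18 / 25 by lra.
rewrite opprK.
have -> : (1 + - t / 2 - (- t) ^+ 2 / 8 - t ^+ 3 / 8) ^+ 2 =
  1 + - t + t ^+ 3 * (- (1/8) + 9 / 64 * t + t ^+ 2 / 32 + t ^+ 3 / 64) by field.
have : 0 <= t ^+ 3 by apply: exprn_ge0; lra.
have : - (1/8) + 9 / 64 * t + t ^+ 2 / 32 + t ^+ 3 / 64 <= 0 by nra.
nra.
Qed.

Lemma sqrt_quad_neg w : - (9 / 20) <= w -> w <= 0 ->
  1 + w / 2 - w ^+ 2 / 6 <= Num.sqrt (1 + w).
Proof.
move=> w1 w0; apply: sqrt_ge.
have -> : (1 + w / 2 - w ^+ 2 / 6) ^+ 2 =
  1 + w - w ^+ 2 * (1 / 12 + w / 6 - w ^+ 2 / 36) by field.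
have : 0 <= w ^+ 2 by exact: sqr_ge0.
have : 0 <= 1 / 12 + w / 6 - w ^+ 2 / 36 by nra.
nra.
Qed.
End RealIneq.

(** * The quadratic forms of the merging step *)

Section Coef.
Variable R : rcfType.
Implicit Types (m a b p S t : R).

(** With r the number of elements of the urn and [m = r - 2], [h_coef m] is the
    coefficient h of the square S^2 in the potential before exposing an element
    and [h_coef (m - 1) = h_coef m + delta_coef m] the one after it.  The numbers
    [mu_coef m] and [- nu_coef m] are the coefficients of x^2 and x S in the change,
    besides [delta_coef m] S^2, of 9/4 times the potential when an element of
    value x moves to F. *)
Definition eta_coef m : R := 4 / 9 / m.
Definition h_coef m : R := 1 / 2 + 4 / 9 / (m + 1).
Definition delta_coef m : R := 4 / 9 / (m * (m + 1)).
Definition mu_coef m : R := 7 / 4 + eta_coef m.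
Definition nu_coef m : R := 1 + 2 * eta_coef m.

(** The form to which the merging step reduces.  The number th is the constant of
    the quadratic error term in the lower bound for the first root, and rho and
    e are the multipliers of two side conditions, see [merge_polynomial_ge0]. *)
Definition merge_form (e th rho m a S : R) : R :=
  ((m + 2) * (1 / 20 + eta_coef m) + 7 / 10 - e * (5 / 4 - (m + 1) / 5)
     - th * mu_coef m ^+ 2 + rho * mu_coef m) * a ^+ 2
  + (- 2 * eta_coef m * (m + 2) + 2 * th * mu_coef m * nu_coef m - rho * nu_coef m) *
      (a * S)
  + ((m + 2) * (m + 3) * delta_coef m / 2 + 7 / 10 * h_coef m + e * h_coef m / 5
     - th * nu_coef m ^+ 2) * S ^+ 2.

Lemma quadform_ge0 (al be ga : R) a S : 0 < al -> be ^+ 2 <= 4 * al * ga ->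
  0 <= al * a ^+ 2 + be * (a * S) + ga * S ^+ 2.
Proof.
move=> al0 disc.
rewrite -(pmulr_rge0 _ al0) -(@pmulr_rge0 _ 4) //.
have -> : 4 * (al * (al * a ^+ 2 + be * (a * S) + ga * S ^+ 2)) =
  (2 * al * a + be * S) ^+ 2 + (4 * al * ga - be ^+ 2) * S ^+ 2 by ring.
by apply: addr_ge0; [exact: sqr_ge0 | apply: mulr_ge0; [lra|exact: sqr_ge0]].
Qed.

Lemma shift_ge1 m : 1 <= m -> exists2 t, 0 <= t & m = 1 + t.
Proof. by move=> m1; exists (m - 1); [lra | ring]. Qed.

Ltac cf_field t0 :=
  rewrite /h_coef /mu_coef /nu_coef /delta_coef /eta_coef; field;
  repeat (apply/andP; split); lra.

Ltac cf_ge0 t0 :=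
  repeat first [exact: t0 | exact: ler0n | exact: ler01 | apply: exprn_ge0
               | apply: mulr_ge0 | apply: addr_ge0].

Ltac cf_gt0 t0 :=
  repeat first [exact: ltr0n | exact: ltr01 | apply: mulr_gt0
               | apply: ltr_wpDr; first by cf_ge0 t0].

Ltac cf_pos t0 :=
  apply: divr_gt0;
    [apply: divr_gt0; cf_gt0 t0
    | apply: mulr_gt0; first [lra | apply: exprn_gt0; lra]].

(** After the substitution [m = 1 + t] the leading coefficient and the negated
    discriminant are quotients of polynomials in t with nonnegative
    coefficients.  These are written in base 1000 because numerals are unary. *)
Lemma form_quarter m a S : 1 <= m -> 0 <= merge_form 0 (1 / 4) 0 m a S.
Proof.
move=> m1; have [t t0 ->] := shift_ge1 m1.
apply: quadform_ge0.
- rewrite [ltRHS](_ : _ = ((50 * 1000 + 774) + (108 * 1000 + 727) * t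
    + (74 * 1000 + 268) * t ^+ 2 + (18 * 1000 + 891) * t ^+ 3 + (1 * 1000 + 296) * t ^+ 4) /
    (25 * 1000 + 920) / ((1 + t) ^+ 2 * (2 + t))); last by cf_field t0.
  by cf_pos t0.
- rewrite -subr_ge0.
  set x := (X in 0 <= X).
  have -> : x = (((15 * 1000 + 661) * 1000 + 348) + ((65 * 1000 + 804) * 1000 + 412) * t
      + ((110 * 1000 + 654) * 1000 + 677) * t ^+ 2
      + ((96 * 1000 + 51) * 1000 + 516) * t ^+ 3 + ((46 * 1000 + 164) * 1000 + 754) * t ^+ 4
      + ((12 * 1000 + 122) * 1000 + 64) * t ^+ 5 + ((1 * 1000 + 572) * 1000 + 381) * t ^+ 6
      + (75 * 1000 + 168) * t ^+ 7) / ((1 * 1000 + 166) * 1000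
      + 400) / ((1 + t) ^+ 4 * (2 + t) ^+ 2) by rewrite /x; cf_field t0.
  by apply: ltW; cf_pos t0.
Qed.

Lemma form_quarter_ab m a S : 1 <= m -> 0 <= merge_form 1 (1 / 4) 0 m a S.
Proof.
move=> m1; have [t t0 ->] := shift_ge1 m1.
apply: quadform_ge0.
- rewrite [ltRHS](_ : _ = ((1 * 1000 + 342) + (1 * 1000 + 787) * t
    + (2 * 1000 + 412) * t ^+ 2 + (3 * 1000 + 519) * t ^+ 3 + (1 * 1000 + 296) * t ^+ 4) /
    (5 * 1000 + 184) / ((1 + t) ^+ 2 * (2 + t))); last by cf_field t0.
  by cf_pos t0.
- rewrite -subr_ge0.
  set x := (X in 0 <= X).
  have -> : x = ((197 * 1000 + 868) + (564 * 1000 + 436) * t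
      + ((1 * 1000 + 407) * 1000 + 823) * t ^+ 2 + ((3 * 1000 + 384) * 1000 + 308) * t ^+ 3
      + ((4 * 1000 + 413) * 1000 + 494) * t ^+ 4 + ((2 * 1000 + 830) * 1000 + 320) * t ^+ 5
      + (858 * 1000 + 375) * t ^+ 6 + (98 * 1000 + 496) * t ^+ 7) / (233 * 1000
      + 280) / ((1 + t) ^+ 4 * (2 + t) ^+ 2) by rewrite /x; cf_field t0.
  by apply: ltW; cf_pos t0.
Qed.

Lemma form_third m a S : 1 <= m -> 0 <= merge_form 0 (1 / 3) (1 / 2) m a S.
Proof.
move=> m1; have [t t0 ->] := shift_ge1 m1.
apply: quadform_ge0.
- rewrite [ltRHS](_ : _ = ((65 * 1000 + 138) + (146 * 1000 + 869) * t
    + (105 * 1000 + 696) * t ^+ 2 + (26 * 1000 + 217) * t ^+ 3 + 972 * t ^+ 4) / (19 * 1000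
    + 440) / ((1 + t) ^+ 2 * (2 + t))); last by cf_field t0.
  by cf_pos t0.
- rewrite -subr_ge0.
  set x := (X in 0 <= X).
  have -> : x = (((12 * 1000 + 717) * 1000 + 916) + ((57 * 1000 + 765) * 1000 + 684) * t
      + ((103 * 1000 + 276) * 1000 + 459) * t ^+ 2
      + ((93 * 1000 + 579) * 1000 + 432) * t ^+ 3
      + ((45 * 1000 + 769) * 1000 + 438) * t ^+ 4
      + ((11 * 1000 + 734) * 1000 + 488) * t ^+ 5 + ((1 * 1000 + 357) * 1000 + 587) * t ^+ 6
      + (41 * 1000 + 796) * t ^+ 7) / (874 * 1000 + 800) / ((1 + t) ^+ 4 * (2 + t) ^+ 2)
      by rewrite /x; cf_field t0.
  by apply: ltW; cf_pos t0.
Qed.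

Lemma form_third_ab m a S : 1 <= m -> 0 <= merge_form 1 (1 / 3) (1 / 2) m a S.
Proof.
move=> m1; have [t t0 ->] := shift_ge1 m1.
apply: quadform_ge0.
- rewrite [ltRHS](_ : _ = ((6 * 1000 + 418) + (14 * 1000 + 405) * t
    + (11 * 1000 + 808) * t ^+ 2 + (5 * 1000 + 49) * t ^+ 3 + 972 * t ^+ 4) / (3 * 1000
    + 888) / ((1 + t) ^+ 2 * (2 + t))); last by cf_field t0.
  by cf_pos t0.
- rewrite -subr_ge0.
  set x := (X in 0 <= X).
  have -> : x = (((1 * 1000 + 331) * 1000 + 652) + ((6 * 1000 + 150) * 1000 + 412) * t
      + ((11 * 1000 + 772) * 1000 + 205) * t ^+ 2
      + ((12 * 1000 + 412) * 1000 + 856) * t ^+ 3 + ((7 * 1000 + 930) * 1000 + 802) * t ^+ 4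
      + ((3 * 1000 + 70) * 1000 + 440) * t ^+ 5 + (658 * 1000 + 341) * t ^+ 6
      + (59 * 1000 + 292) * t ^+ 7) / (174 * 1000 + 960) / ((1 + t) ^+ 4 * (2 + t) ^+ 2)
      by rewrite /x; cf_field t0.
  by apply: ltW; cf_pos t0.
Qed.
End Coef.

Section Core.
Variable R : rcfType.
Implicit Types (m a b p S t : R).

Lemma eta_coef_ge0 m : 1 <= m -> 0 <= eta_coef m.
Proof. by move=> m1; rewrite /eta_coef divr_ge0 //; lra. Qed.
Lemma delta_coef_ge0 m : 1 <= m -> 0 <= delta_coef m.
Proof. by move=> m1; rewrite /delta_coef divr_ge0 // ?mulr_ge0 //; lra. Qed.
Lemma h_coef_gt0 m : 1 <= m -> 1 / 2 < h_coef m.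
Proof.
move=> m1; rewrite /h_coef.
have : 0 < 4 / 9 / (m + 1) :> R by apply: divr_gt0; lra.
lra.
Qed.

Lemma form_linear m a S : 1 <= m ->
  0 <= (1 / 20 + eta_coef m) * a ^+ 2 + (- 2 * eta_coef m) * (a * S)
       + ((m + 3) * delta_coef m / 2) * S ^+ 2.
Proof.
move=> m1; apply: quadform_ge0.
  by have := eta_coef_ge0 m1; lra.
rewrite -subr_ge0; set x := (X in 0 <= X).
have -> : x = 8 / 9 * ((m - 53 / 18) ^+ 2 / 20 + (4 / 9 - 53 ^+ 2 / (18 ^+ 2 * 20))) /
    (m ^+ 2 * (m + 1)).
  rewrite /x /eta_coef /delta_coef; field; repeat (apply/andP; split); lra.
apply: divr_ge0; last by apply: mulr_ge0; [apply: exprn_ge0|]; lra.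
apply: mulr_ge0; first by lra.
have : 0 <= (m - 53 / 18) ^+ 2 by exact: sqr_ge0.
lra.
Qed.

(** The polynomial inequality to which the merging step reduces once the roots
    are expanded.  Here a is the element of smallest absolute value, p the sum
    of the squares of the others and b a bound for their absolute values, all
    normalized so that the potential is at most 1.  The inequality
    ab <= (5/4) a^2 + b^2 / 5 removes b; then p enters linearly, through its
    upper bound.  By the normalization, the resulting expression is at least
    a^2 times [merge_form k th rho m a S]; k records whether the excess of the
    bound for ab over 1/5 has to be paid for. *)
Lemma merge_polynomial_ge0 th rho m a S p b :
  (forall k : R, (k = 0) \/ (k = 1) ->
   0 <= merge_form k th rho m a S) ->
  0 <= rho -> 0 <= rho * a * (nu_coef m * S - mu_coef m * a) ->
  1 <= m -> 0 <= a -> (m + 2) * a ^+ 2 + h_coef m * S ^+ 2 <= 1 ->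
  0 <= p -> p <= 1 - a ^+ 2 - h_coef m * S ^+ 2 ->
  0 <= b -> b ^+ 2 = 1 - (m + 1) * a ^+ 2 - h_coef m * S ^+ 2 ->
  0 <= (m + 3) * delta_coef m * S ^+ 2 / 2 + (3 / 4 + eta_coef m) * a ^+ 2
       - 2 * eta_coef m * a * S - th * (mu_coef m * a ^+ 2 - nu_coef m * a * S) ^+ 2
       - a ^+ 2 * p / 2 - a ^+ 2 * (a * b) * p.
Proof.
move=> FF rho0 side m1 a0 qle p0 ple b0 bE.
have h0 := h_coef_gt0 m1.
have S2 : 0 <= S ^+ 2 by exact: sqr_ge0.
have A0 : 0 <= a ^+ 2 by exact: sqr_ge0.
have hS0 : 0 <= h_coef m * S ^+ 2 by apply: mulr_ge0 => //; lra.
pose A := a ^+ 2; pose T := h_coef m * S ^+ 2.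
have mA : 0 <= m * A by apply: mulr_ge0 => //; lra.
have QQ0 := form_linear a S m1.
set QQ := (X in 0 <= X) in QQ0.
(* The normalization bounds (m + 2) a^2 by 1, which homogenizes QQ. *)
have QQ1 : (m + 2) * A * QQ <= QQ.
  have : (m + 2) * A <= 1 by rewrite /A; lra.
  by move=> h; rewrite -[leRHS]mul1r ler_wpM2r.
have ab : a * b <= 5 / 4 * A + 1 / 5 * b ^+ 2.
  have : 0 <= (5 / 2 * a - b) ^+ 2 by exact: sqr_ge0.
  rewrite /A; lra.
pose kap := A * (5 / 4 - (m + 1) / 5) - T / 5.
have ab' : a * b <= 1 / 5 + kap.
  by apply: le_trans ab _; rewrite bE /kap /A /T; lra.
have p1 : p <= 1 by lra.
have [k kE kkap] : exists2 k : R, k = 0 \/ k = 1 & a * b * p <= p / 5 + k * kap.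
  have abp : a * b * p <= (1 / 5 + kap) * p by rewrite ler_wpM2r.
  have [k0|k0] := leP 0 kap.
    exists 1; first by right.
    have : kap * p <= kap by rewrite -[leRHS]mulr1 ler_wpM2l.
    lra.
  exists 0; first by left.
  have : kap * p <= 0 by apply: mulr_le0_ge0 => //; lra.
  lra.
have := FF k kE; set G := (X in 0 <= X) => G0.
have AG : 0 <= A * G by apply: mulr_ge0.
have sideA : 0 <= A * (rho * a * (nu_coef m * S - mu_coef m * a)) by apply: mulr_ge0.
have step1 : A * (a * b * p) <= A * (p / 5 + k * kap) by rewrite ler_wpM2l.
have step2 : A * p <= A * (1 - A - T) by rewrite ler_wpM2l.
set goal := (X in 0 <= X).
have gE : goal = QQ + 7 / 10 * A - th * (mu_coef m * a ^+ 2 - nu_coef m * a * S) ^+ 2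
       - A * p / 2 - A * (a * b * p).
  by rewrite /goal /QQ /A; field.
have GE : A * G = (m + 2) * A * QQ + 7 / 10 * A * (A + T) - k * A * kap
   - th * (mu_coef m * a ^+ 2 - nu_coef m * a * S) ^+ 2
       - A * (rho * a * (nu_coef m * S - mu_coef m * a)).
  by rewrite /G /merge_form /QQ /kap /A /T; field.
rewrite gE.
lra.
Qed.
End Core.

(** * The merging step *)

Section Step.
Variable R : rcfType.
Implicit Types (m a b p S t : R).

(** Keeps the argument of the first root in the range where the quadratic lower
    bound [sqrt_quad_neg] holds. *)
Lemma first_arg_ge m a S : 1 <= m -> 0 <= a -> (m + 2) * a ^+ 2 + h_coef m * S ^+ 2 <= 1 ->
  - (9 / 20) <= mu_coef m * a ^+ 2 - nu_coef m * a * S.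
Proof.
move=> m1 a0 le1.
have : 0 <= (mu_coef m + 9 / 20 * (m + 2)) * a ^+ 2 + (- nu_coef m) * (a * S)
    + (9 / 20 * h_coef m) * S ^+ 2.
  apply: quadform_ge0.
    have := eta_coef_ge0 m1; rewrite /mu_coef; lra.
  rewrite -subr_ge0; set x := (X in 0 <= X).
  have [t t0 mE] := shift_ge1 m1.
  have -> : x = (9 / 5 * (9 / 20 * m ^+ 2 + 53 / 20 * m + 4 / 9) * (m / 2 + 17 / 18) * m
     - (m + 8 / 9) ^+ 2 * (m + 1)) / (m ^+ 2 * (m + 1)).
    rewrite /x /mu_coef /nu_coef /h_coef /eta_coef mE; field; repeat (apply/andP; split);
        lra.
  apply: divr_ge0; last by apply: mulr_ge0; [apply: exprn_ge0|]; lra.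
  rewrite mE; nra.
lra.
Qed.

(** The root of the first alternative, where the exposed element moves to F.
    The error constant is 1/4 for a nonnegative z and 1/3 for a negative one.
    The larger constant is paid for by the sign of z, which is what the
    multiplier [rho] expresses. *)
Lemma sqrt_first_ge m a S k : 1 <= m -> 0 <= a -> (m + 2) * a ^+ 2 + h_coef m * S ^+ 2
    <= 1 ->
  1 <= k ->
  exists th rho : R, [/\ 0 <= rho,
    (forall e : R, (e = 0) \/ (e = 1) ->
   0 <= merge_form e th rho m a S),
    0 <= rho * a * (nu_coef m * S - mu_coef m * a) &
    let z := mu_coef m * a ^+ 2 - nu_coef m * a * S in
    k + (z - th * z ^+ 2) / 2 / k <= Num.sqrt (k ^+ 2 + z)].
Proof.
move=> m1 a0 le1 k1.
have zlow := first_arg_ge m1 a0 le1.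
set z := _ - _ in zlow *.
have k0 : 0 < k by lra.
have kV : k^-1 <= 1 by rewrite invf_le1.
have kV0 : 0 < k^-1 by rewrite invr_gt0.
pose w := z / k ^+ 2.
have sqE : Num.sqrt (k ^+ 2 + z) = k * Num.sqrt (1 + w).
  have -> : k ^+ 2 + z = k ^+ 2 * (1 + w) by rewrite /w; field; lra.
  by rewrite sqrtrM ?sqr_ge0 // sqrtr_sqr gtr0_norm.
have w2 : k * w ^+ 2 <= z ^+ 2 / k.
  have -> : k * w ^+ 2 = z ^+ 2 / k * (k^-1) ^+ 2 by rewrite /w; field; lra.
  rewrite -[leRHS]mulr1 ler_wpM2l ?divr_ge0 ?sqr_ge0 //; first by lra.
  by rewrite expr_le1 //; lra.
have kw : k * w = z / k by rewrite /w; field; lra.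
have [zp|zn] := leP 0 z.
  exists (1/4), 0; split => //.
  - by move=> e [] ->; [exact: form_quarter | exact: form_quarter_ab].
  - by rewrite !mul0r.
  - rewrite /= sqE.
    have wp : 0 <= w by rewrite /w divr_ge0 ?sqr_ge0.
    have := sqrt_quad_pos wp.
    move/(ler_wpM2l (ltW k0)); apply: le_trans.
    have -> : (z - 1 / 4 * z ^+ 2) / 2 / k = z / k / 2 - z ^+ 2 / k / 8 by field; lra.
    lra.
exists (1/3), (1/2); split.
- lra.
- by move=> e [] ->; [exact: form_third | exact: form_third_ab].
- have -> : 1 / 2 * a * (nu_coef m * S - mu_coef m * a) = - z / 2 by rewrite /z; field.
  lra.
- rewrite /= sqE.
  have wn : w <= 0 by rewrite /w pmulr_lle0 ?invr_gt0 ?exprn_gt0 //; lra.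
  have wl : - (9 / 20) <= w.
    have : z <= w.
      rewrite /w -[leLHS]mulr1 ler_wnM2l //; first lra.
      by rewrite -exprVn expr_le1 //; lra.
    lra.
  have := sqrt_quad_neg wl wn.
  move/(ler_wpM2l (ltW k0)); apply: le_trans.
  have -> : (z - 1 / 3 * z ^+ 2) / 2 / k = z / k / 2 - z ^+ 2 / k / 6 by field; lra.
  lra.
Qed.

(** The root of the alternative in which the exposed element a merges with an
    element c.  The cubic error is bounded by means of |c| <= b, so that the
    sum over all c depends only on the sum of c and the sum of c^2. *)
Lemma sqrt_other_ge a b c k : 0 <= a -> 0 <= b -> `|c| <= b -> 1 <= k ->
  2 * (a * b) <= 18 / 25 ->
  k + (a * c - a ^+ 2 * c ^+ 2 / 2 - a ^+ 2 * (a * b) * c ^+ 2) / k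
    <= Num.sqrt (k ^+ 2 + 2 * a * c).
Proof.
move=> a0 b0 cb k1 ab.
have k0 : 0 < k by lra.
have kV : k^-1 <= 1 by rewrite invf_le1.
have kV0 : 0 < k^-1 by rewrite invr_gt0.
pose w := 2 * a * c / k ^+ 2.
have sqE : Num.sqrt (k ^+ 2 + 2 * a * c) = k * Num.sqrt (1 + w).
  have -> : k ^+ 2 + 2 * a * c = k ^+ 2 * (1 + w) by rewrite /w; field; lra.
  by rewrite sqrtrM ?sqr_ge0 // sqrtr_sqr gtr0_norm.
have absw : `|w| = 2 * a * `|c| * (k^-1) ^+ 2.
  rewrite /w -exprVn normrM normrX (gtr0_norm kV0) normrM ger0_norm //.
  by apply: mulr_ge0.
have kV2 : (k^-1) ^+ 2 <= 1 by rewrite expr_le1 //; lra.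
have ac : a * `|c| <= a * b by rewrite ler_wpM2l.
have wl : - (18 / 25) <= w.
  have : `|w| <= 18 / 25.
    have c0 : 0 <= 2 * a * `|c| by rewrite !mulr_ge0.
    rewrite absw -[leRHS]mulr1 ler_pM ?sqr_ge0 //; lra.
  by rewrite ler_norml => /andP[].
rewrite sqE.
have := sqrt_cubic wl; move/(ler_wpM2l (ltW k0)); apply: le_trans.
have kw : k * w = 2 * (a * c / k) by rewrite /w; field; lra.
have w2 : k * w ^+ 2 <= 4 * (a ^+ 2 * c ^+ 2 / k).
  have -> : k * w ^+ 2 = 4 * (a ^+ 2 * c ^+ 2 / k) * (k^-1) ^+ 2 by rewrite /w; field; lra.
  have Y0 : 0 <= a ^+ 2 * c ^+ 2 / k.
    by apply: divr_ge0; [apply: mulr_ge0; exact: sqr_ge0 | exact: ltW].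
  by rewrite -[leRHS]mulr1 ler_wpM2l // mulr_ge0.
have w3 : k * `|w| ^+ 3 <= 8 * (a ^+ 2 * (a * b) * c ^+ 2 / k).
  have -> : k * `|w| ^+ 3 = 8 * (a ^+ 2 * (a * `|c|) * `|c| ^+ 2 / k) *
      ((k^-1) ^+ 2 * (k^-1) ^+ 2).
    by rewrite absw; field; lra.
  rewrite real_normK ?num_real //.
  have X0 : 0 <= 8 * (a ^+ 2 * (a * `|c|) * c ^+ 2 / k).
    apply: mulr_ge0 => //; apply: divr_ge0; last exact: ltW.
    by apply: mulr_ge0 (sqr_ge0 _); apply: mulr_ge0; [exact: sqr_ge0 | exact: mulr_ge0].
  apply: le_trans (_ : 8 * (a ^+ 2 * (a * `|c|) * c ^+ 2 / k) <= _).
    rewrite -[leRHS]mulr1 ler_wpM2l // mulr_ile1 ?sqr_ge0 //.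
  rewrite ler_wpM2l // ler_wpM2r ?(ltW kV0) // ler_wpM2r ?sqr_ge0 //.
  by rewrite ler_wpM2l ?sqr_ge0.
rewrite -subr_ge0.
have -> : (a * c - a ^+ 2 * c ^+ 2 / 2 - a ^+ 2 * (a * b) * c ^+ 2) / k
  = a * c / k - a ^+ 2 * c ^+ 2 / k / 2 - a ^+ 2 * (a * b) * c ^+ 2 / k by field; lra.
lra.
Qed.

(** The induction step with the potential before the step scaled to 1.  Both
    kinds of roots have the common part k^2 = 1 + delta S^2; after expansion
    around k, the sum over j only involves the sums of a_j and of a_j^2. *)
Lemma merge_step_normalized (I : finType) (Q : {set I}) (a : I -> R) (x : R) (n : nat) :
  let m := n.+1%:R : R in
  let S := x + \sum_(j in Q) a j in
  #|Q| = n.+2 ->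
  (forall j, j \in Q -> `|x| <= `|a j|) ->
  x ^+ 2 + \sum_(j in Q) a j ^+ 2 + h_coef m * S ^+ 2 <= 1 ->
  m + 3 <= 2 * Num.sqrt (1 + delta_coef m * S ^+ 2 + mu_coef m * x ^+ 2 - nu_coef m * x * S)
           + \sum_(j in Q) Num.sqrt (1 + delta_coef m * S ^+ 2 + 2 * x * a j).
Proof.
(* All quantities are invariant under negating x and all a_j. *)
wlog x0 : a x / 0 <= x => [wl|].
  have [x0|x0] := leP 0 x; first exact: wl.
  move=> m S cQ small le1.
  have := wl (fun j => - a j) (- x); rewrite /= -/m.
  have -> : - x + \sum_(j in Q) - a j = - S by rewrite sumrN /S opprD.
  have -> : \sum_(j in Q) (- a j) ^+ 2 = \sum_(j in Q) a j ^+ 2.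
    by apply: eq_bigr => j _; rewrite sqrrN.
  rewrite !sqrrN; have -> : nu_coef m * - x * - S = nu_coef m * x * S by ring.
  have -> : \sum_(j in Q) Num.sqrt (1 + delta_coef m * S ^+ 2 + 2 * - x * - a j) =
    \sum_(j in Q) Num.sqrt (1 + delta_coef m * S ^+ 2 + 2 * x * a j).
    by apply: eq_bigr => j _; congr (Num.sqrt (_ + _)); ring.
  apply => //; first by lra.
  by move=> j jQ; rewrite !normrN; exact: small.
move=> m S cQ small le1.
have m1 : 1 <= m by rewrite /m ler1n.
set p := \sum_(j in Q) a j ^+ 2 in le1.
have x2j j : j \in Q -> x ^+ 2 <= a j ^+ 2.
  move=> /small; rewrite (ger0_norm x0) => h.
  by rewrite -[a j ^+ 2]real_normK ?num_real // ler_sqr ?nnegrE.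
have cardE T : \sum_(j in Q) T = (m + 1) * T :> R.
  by rewrite sumr_const cQ /m natr1 mulr_natl.
have pge : (m + 1) * x ^+ 2 <= p.
  by rewrite -cardE /p; apply: ler_sum => j jQ; exact: x2j.
have d0 := delta_coef_ge0 m1.
have S20 : 0 <= S ^+ 2 by exact: sqr_ge0.
have dS0 : 0 <= delta_coef m * S ^+ 2 by apply: mulr_ge0.
have bnd j : j \in Q -> a j ^+ 2 <= 1 - (m + 1) * x ^+ 2 - h_coef m * S ^+ 2.
  move=> jQ.
  have : a j ^+ 2 + m * x ^+ 2 <= p.
    rewrite /p (bigD1 j) //= lerD2l.
    have -> : m * x ^+ 2 = \sum_(i in Q | i != j) x ^+ 2.
      have := cardE (x ^+ 2); rewrite (bigD1 j) //=.
      lra.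
    by apply: ler_sum => i /andP[iQ _]; exact: x2j.
  lra.
pose B2 := 1 - (m + 1) * x ^+ 2 - h_coef m * S ^+ 2.
have [j0 j0Q] : exists j, j \in Q by apply/set0Pn; rewrite -card_gt0 cQ.
have B20 : 0 <= B2 by apply: le_trans (bnd j0 j0Q); exact: sqr_ge0.
pose b := Num.sqrt B2.
have b0 : 0 <= b by exact: sqrtr_ge0.
have bE : b ^+ 2 = B2 by rewrite sqr_sqrtr.
have hS0 : 0 <= h_coef m * S ^+ 2 by apply: mulr_ge0 => //; have := h_coef_gt0 m1; lra.
have ab : 2 * (x * b) <= 18 / 25.
  have xb0 : 0 <= x * b by apply: mulr_ge0.
  have h2 : (x * b) ^+ 2 <= 1 / 8.
    rewrite exprMn bE /B2.
    have : x ^+ 2 * (1 - (m + 1) * x ^+ 2 - h_coef m * S ^+ 2) <= x ^+ 2 * (1 - 2 * x ^+ 2).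
      rewrite ler_wpM2l ?sqr_ge0 //.
      have : 2 * x ^+ 2 <= (m + 1) * x ^+ 2 by rewrite ler_wpM2r ?sqr_ge0 //; lra.
      lra.
    have : 0 <= (x ^+ 2 - 1 / 4) ^+ 2 by exact: sqr_ge0.
    lra.
  nra.
pose k := Num.sqrt (1 + delta_coef m * S ^+ 2).
have k2 : k ^+ 2 = 1 + delta_coef m * S ^+ 2 by rewrite sqr_sqrtr //; lra.
have k1 : 1 <= k by rewrite /k -[leLHS]sqrtr1 ler_wsqrtr //; lra.
have qle : (m + 2) * x ^+ 2 + h_coef m * S ^+ 2 <= 1 by lra.
have [th [rho [rho0 FF side ft]]] := sqrt_first_ge m1 x0 qle k1.
have core := merge_polynomial_ge0 FF rho0 side m1 x0 qle _ _ b0 bE.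
have p0 : 0 <= p by apply: sumr_ge0 => j _; exact: sqr_ge0.
have ple : p <= 1 - x ^+ 2 - h_coef m * S ^+ 2 by lra.
have {core} := core p p0 ple.
set z := mu_coef m * x ^+ 2 - nu_coef m * x * S in ft *.
have {ft} : k + (z - th * z ^+ 2) / 2 / k <= Num.sqrt (k ^+ 2 + z) by [].
rewrite k2 addrA => ft core.
have others : \sum_(j in Q) (k + (x * a j - x ^+ 2 * a j ^+ 2 / 2
    - x ^+ 2 * (x * b) * a j ^+ 2) / k)
    <= \sum_(j in Q) Num.sqrt (1 + delta_coef m * S ^+ 2 + 2 * x * a j).
  apply: ler_sum => j jQ; rewrite -k2; apply: sqrt_other_ge => //.
  have := bnd j jQ; rewrite -/B2 -bE -[a j ^+ 2]real_normK ?num_real //.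
  by rewrite ler_sqr ?nnegrE.
have sumE : \sum_(j in Q) (k + (x * a j - x ^+ 2 * a j ^+ 2 / 2
    - x ^+ 2 * (x * b) * a j ^+ 2) / k)
  = (m + 1) * k + (x * (S - x) - x ^+ 2 * p / 2 - x ^+ 2 * (x * b) * p) / k.
  rewrite big_split /= cardE; congr (_ + _).
  rewrite -big_distrl /=; congr (_ / _).
  rewrite !sumrB -!mulr_sumr; congr (_ - _ - _).
    by congr (_ * _); rewrite /S; ring.
  by rewrite -big_distrl /= -mulr_sumr.
rewrite sumE in others.
have k0 : 0 < k by lra.
pose B := z - th * z ^+ 2 + (x * (S - x) - x ^+ 2 * p / 2 - x ^+ 2 * (x * b) * p).
(* B is k times the sum of the corrections to k in the bounds for all roots. *)
suff key : m + 3 <= (m + 3) * k + B / k.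
  apply: le_trans key _.
  have -> : B / k = 2 * ((z - th * z ^+ 2) / 2 / k)
      + (x * (S - x) - x ^+ 2 * p / 2 - x ^+ 2 * (x * b) * p) / k.
    by rewrite /B; field; lra.
  lra.
rewrite -(ler_pM2r k0) [leRHS]mulrDl divfK ?gt_eqF //.
have BE : B = (3 / 4 + eta_coef m) * x ^+ 2 - 2 * eta_coef m * x * S - th * z ^+ 2
  - x ^+ 2 * p / 2 - x ^+ 2 * (x * b) * p.
  by rewrite /B /z /mu_coef /nu_coef; field.
have kk : (m + 3) * (delta_coef m * S ^+ 2) / 2 <= (m + 3) * (k * k - k).
  rewrite -mulrA ler_wpM2l //; first lra.
  have : 0 <= (k - 1) ^+ 2 by exact: sqr_ge0.
  lra.
have -> : (m + 3) * k * k = (m + 3) * (k * k - k) + (m + 3) * k by ring.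
have dE : (m + 3) * (delta_coef m * S ^+ 2) / 2 = (m + 3) * delta_coef m * S ^+ 2 / 2
    by field.
lra.
Qed.

End Step.

(** * Averages over subsets and the Khintchine inequality *)

Section Subsets.
Variable V : finType.
Implicit Types (M T : {set V}) (i j : V).

Lemma set_ind1 (P : {set V} -> Prop) :
  P set0 -> (forall i M, i \notin M -> P M -> P (i |: M)) -> forall M, P M.
Proof.
move=> P0 PS M; move: {2}#|M| (erefl #|M|) => n; elim: n M => [|n IH] M.
  by move/eqP; rewrite cards_eq0 => /eqP ->.
move=> cM; have [i iM] : exists i, i \in M by apply/set0Pn; rewrite -card_gt0 cM.
rewrite -(setD1K iM); apply: PS; first by rewrite setD11.
by apply: IH; move: cM; rewrite (cardsD1 i) iM => -[].
Qed.

Lemma sum_subsetU1 (R : zmodType) M i (F : {set V} -> R) : i \notin M ->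
  \sum_(T : {set V} | T \subset i |: M) F T
      = \sum_(T : {set V} | T \subset M) (F T + F (i |: T)).
Proof.
move=> iM; rewrite (bigID (fun T : {set V} => i \in T)) /= addrC big_split /=;
    congr (_ + _).
  apply: eq_bigl => T; apply/andP/idP => [[TM iT]|TM].
    apply/subsetP => j jT; have := subsetP TM j jT; rewrite in_setU1 => /orP[/eqP ji|//].
    by rewrite -ji jT in iT.
  split; first by apply: subset_trans TM (subsetUr _ _).
  by apply: contra iM => /(subsetP TM).
rewrite (reindex_onto (fun T => i |: T) (fun T => T :\ i)) /=; last first.
  by move=> T /andP[_ iT]; rewrite setD1K.
apply: eq_bigl => T; rewrite setU11 andbT; apply/andP/idP => [[TM /eqP TE]|TM].
  have iT : i \notin T by rewrite -TE setD11.
  apply/subsetP => j jT; have := subsetP TM j; rewrite !in_setU1 jT orbT => /(_ isT).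
  by case/orP => // /eqP ji; rewrite -ji jT in iT.
split; first by apply: setUS.
by apply/eqP; apply: setU1K; apply: contra iM => /(subsetP TM).
Qed.

Definition flip j T : {set V} := if j \in T then T :\ j else j |: T.

Lemma in_flip j T i : (i \in flip j T) = if i == j then i \notin T else i \in T.
Proof.
rewrite /flip; case: ifPn => jT; rewrite ?in_setD1 ?in_setU1; case: eqVneq => [->|_] //=.
by rewrite jT.
Qed.

Lemma flipK j : involutive (flip j).
Proof. by move=> T; apply/setP => i; rewrite !in_flip; case: eqP => // ->;
    rewrite negbK. Qed.

Lemma flip_sub j M T : j \in M -> (flip j T \subset M) = (T \subset M).
Proof.
move=> jM; rewrite /flip; case: ifPn => jT.
  by rewrite subDset (setUidPr _) ?sub1set.
by rewrite subUset sub1set jM.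
Qed.

Lemma flipU1 i j T : i != j -> flip j (i |: T) = i |: flip j T.
Proof.
move=> ij; apply/setP => k; rewrite in_flip !in_setU1 in_flip.
by case: eqVneq => // ->; rewrite eq_sym (negbTE ij).
Qed.

Lemma flip_new i T : i \notin T -> flip i T = i |: T.
Proof. by rewrite /flip => /negbTE ->. Qed.

Lemma flip_old i T : i \notin T -> flip i (i |: T) = T.
Proof. by move=> iT; rewrite /flip setU11 setU1K. Qed.
End Subsets.

Section Average.
Variables (R : rcfType) (V : finType).
Implicit Types (M T : {set V}) (i j : V) (f g : {set V} -> R) (a : V -> R).

Definition avg M f : R := (\sum_(T : {set V} | T \subset M) f T) / 2 ^+ #|M|.

Lemma avg0 f : avg set0 f = f set0.
Proof.
rewrite /avg cards0 expr0 divr1 (big_pred1 set0) // => T.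
by rewrite subset0.
Qed.

Lemma eq_avg M f g : (forall T, T \subset M -> f T = g T) -> avg M f = avg M g.
Proof. by move=> fg; rewrite /avg; congr (_ / _); apply: eq_bigr. Qed.

Lemma avgU1 M i f : i \notin M ->
  avg (i |: M) f = (avg M f + avg M (fun T => f (i |: T))) / 2.
Proof.
move=> iM; rewrite /avg sum_subsetU1 // cardsU1 iM big_split /= exprS.
by field; rewrite expf_neq0 ?pnatr_eq0.
Qed.

Lemma avgD M f g : avg M (fun T => f T + g T) = avg M f + avg M g.
Proof. by rewrite /avg big_split /= mulrDl. Qed.

Lemma avgZ M c f : avg M (fun T => c * f T) = c * avg M f.
Proof. by rewrite /avg -mulr_sumr mulrA. Qed.

Lemma avgB M f g : avg M (fun T => f T - g T) = avg M f - avg M g.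
Proof. by rewrite /avg big_split /= sumrN mulrBl. Qed.

Lemma avg_sum (J : finType) (P : pred J) M (F : J -> {set V} -> R) :
  avg M (fun T => \sum_(j | P j) F j T) = \sum_(j | P j) avg M (F j).
Proof. by rewrite /avg exchange_big /= mulr_suml. Qed.

Lemma le_avg M f g : (forall T, T \subset M -> f T <= g T) -> avg M f <= avg M g.
Proof.
by move=> fg; rewrite /avg ler_pM2r ?invr_gt0 ?exprn_gt0 //; apply: ler_sum.
Qed.

Lemma avg_ge0 M f : (forall T, T \subset M -> 0 <= f T) -> 0 <= avg M f.
Proof. by move=> f0; rewrite /avg divr_ge0 ?exprn_ge0 // sumr_ge0. Qed.

Lemma avg_flip M j f : j \in M -> avg M (fun T => f (flip j T)) = avg M f.
Proof.
move=> jM; rewrite /avg; congr (_ / _).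
rewrite [RHS](reindex_onto (flip j) (flip j)) /=; last by move=> T _; rewrite flipK.
by apply: eq_bigl => T; rewrite flip_sub // flipK eqxx andbT.
Qed.

(** A subset T of M stands for the assignment of signs that is 1 on T and -1 on
    M - T, so that complementation is the global sign change. *)
Lemma avg_compl M f : avg M (fun T => f (M :\: T)) = avg M f.
Proof.
rewrite /avg; congr (_ / _).
rewrite [RHS](reindex_onto (fun T => M :\: T) (fun T => M :\: T)) /=; last first.
  by move=> T TM; rewrite setDDr setDv set0U; apply/setIidPr.
apply: eq_bigl => T; rewrite subsetDl /= setDDr setDv set0U.
by apply/idP/eqP => [/setIidPr|/setIidPr].
Qed.

(** The Dirichlet form of the simple random walk on the hypercube, which equals
    the sum of |W| c_W^2 over all W, where c_W are the Walsh coefficients. *)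
Definition dirichlet M f : R :=
  (\sum_(j in M) avg M (fun T => (f T - f (flip j T)) ^+ 2)) / 4.

Lemma dirichlet_ge0 M f : 0 <= dirichlet M f.
Proof.
by rewrite /dirichlet divr_ge0 // sumr_ge0 // => j _; apply: avg_ge0 => T _; exact: sqr_ge0.
Qed.

(** The two Walsh components of f with respect to i; the odd one is taken with
    the opposite sign. *)
Definition evenpart i f T := (f T + f (i |: T)) / 2.
Definition oddpart i f T := (f T - f (i |: T)) / 2.

Lemma avg_sqr_split M i f : i \notin M ->
  avg (i |: M) (fun T => f T ^+ 2) =
  avg M (fun T => evenpart i f T ^+ 2) + avg M (fun T => oddpart i f T ^+ 2).
Proof.
move=> iM; rewrite avgU1 // -!avgD mulrC -avgZ.
by apply: eq_avg => T _; rewrite /evenpart /oddpart; field.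
Qed.

Lemma avg_split M i f : i \notin M -> avg (i |: M) f = avg M (evenpart i f).
Proof.
move=> iM; rewrite avgU1 // -!avgD mulrC -avgZ.
by apply: eq_avg => T _; rewrite /evenpart; field.
Qed.

Lemma dirichlet_split M i f : i \notin M ->
  dirichlet (i |: M) f =
  dirichlet M (evenpart i f) + dirichlet M (oddpart i f)
      + avg M (fun T => oddpart i f T ^+ 2).
Proof.
move=> iM; rewrite /dirichlet big_setU1 //=.
have -> : avg (i |: M) (fun T => (f T - f (flip i T)) ^+ 2)
    = 4 * avg M (fun T => oddpart i f T ^+ 2).
  rewrite avgU1 // -!avgD mulrC -!avgZ; apply: eq_avg => T TM.
  have iT : i \notin T by apply: contra iM => /(subsetP TM).
  by rewrite flip_old // flip_new // /oddpart; field.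
have -> : \sum_(j in M) avg (i |: M) (fun T => (f T - f (flip j T)) ^+ 2) =
   \sum_(j in M) avg M (fun T => (evenpart i f T - evenpart i f (flip j T)) ^+ 2) +
   \sum_(j in M) avg M (fun T => (oddpart i f T - oddpart i f (flip j T)) ^+ 2).
  rewrite -big_split /=; apply: eq_bigr => j jM.
  have ij : i != j by apply: contraNneq iM => ->.
  rewrite avgU1 // -!avgD mulrC -!avgZ; apply: eq_avg => T TM.
  by rewrite flipU1 // /evenpart /oddpart; field.
by field.
Qed.

(** Variance is the sum of c_W^2 over nonempty W, and |W| >= 1 there.  By
    induction over the coordinates no Walsh expansion is needed. *)
Lemma poincare M f : avg M (fun T => f T ^+ 2) - avg M f ^+ 2 <= dirichlet M f.
Proof.
elim/set_ind1: M f => [|i M iM IH] f.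
  by rewrite !avg0 subrr dirichlet_ge0.
rewrite avg_sqr_split // avg_split // dirichlet_split //.
have := IH (evenpart i f); have := dirichlet_ge0 M (oddpart i f); lra.
Qed.

Definition sgn j T : R := if j \in T then 1 else -1.

(** Without its first-level coefficients, a function has a spectral gap of 2
    instead of 1. *)
Lemma poincare_level2 M f :
  2 * (avg M (fun T => f T ^+ 2) - avg M f ^+ 2) <=
  dirichlet M f + \sum_(j in M) avg M (fun T => f T * sgn j T) ^+ 2.
Proof.
elim/set_ind1: M f => [|i M iM IH] f.
  by rewrite !avg0 subrr mulr0 big_set0 addr0 dirichlet_ge0.
rewrite avg_sqr_split // avg_split // dirichlet_split // big_setU1 //=.
have -> : avg (i |: M) (fun T => f T * sgn i T) = - avg M (oddpart i f).
  rewrite avgU1 // -!avgD mulrC -avgZ -mulN1r -avgZ; apply: eq_avg => T TM.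
  have iT : i \notin T by apply: contra iM => /(subsetP TM).
  by rewrite /sgn setU11 (negbTE iT) /oddpart; field.
have -> : \sum_(j in M) avg (i |: M) (fun T => f T * sgn j T) ^+ 2 =
  \sum_(j in M) avg M (fun T => evenpart i f T * sgn j T) ^+ 2.
  apply: eq_bigr => j jM; congr (_ ^+ 2).
  have ji : j != i by apply: contraNneq iM => <-.
  rewrite avgU1 // -!avgD mulrC -avgZ; apply: eq_avg => T TM.
  by rewrite /sgn in_setU1 (negbTE ji) /= /evenpart; field.
rewrite sqrrN.
have := IH (evenpart i f); have := poincare M (oddpart i f); lra.
Qed.

Definition signed_sum M a T : R := \sum_(j in M) (if j \in T then a j else - a j).

Lemma signed_sum_compl M a T : signed_sum M a (M :\: T) = - signed_sum M a T.
Proof.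
rewrite /signed_sum -sumrN; apply: eq_bigr => j jM.
by rewrite in_setD jM andbT; case: (j \in T); rewrite /= ?opprK.
Qed.

Lemma signed_sumU1 M a i T : i \notin M -> T \subset M ->
  (signed_sum (i |: M) a T = signed_sum M a T - a i) *
  (signed_sum (i |: M) a (i |: T) = signed_sum M a T + a i).
Proof.
move=> iM TM; have iT : i \notin T by apply: contra iM => /(subsetP TM).
rewrite /signed_sum !big_setU1 //= (negbTE iT) setU11 addrC; split=> //.
rewrite addrC; congr (_ + _); apply: eq_bigr => j jM; rewrite in_setU1.
by have -> : (j == i) = false by apply: contraNF iM => /eqP <-.
Qed.

Lemma signed_sum_flip M a j T : j \in M ->
  signed_sum M a (flip j T) = signed_sum M a T - 2 * (if j \in T then a j else - a j).
Proof.
move=> jM; rewrite /signed_sum (bigD1 j) //= [in RHS](bigD1 j) //= in_flip eqxx.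
have -> : \sum_(i in M | i != j) (if i \in flip j T then a i else - a i) =
  \sum_(i in M | i != j) (if i \in T then a i else - a i).
  by apply: eq_bigr => i /andP[_ ij]; rewrite in_flip (negbTE ij).
by case: (j \in T) => /=; ring.
Qed.

Lemma avg_signed_sqr M a c :
  avg M (fun T => (c + signed_sum M a T) ^+ 2) = c ^+ 2 + \sum_(j in M) a j ^+ 2.
Proof.
elim/set_ind1: M c => [|i M iM IH] c.
  by rewrite avg0 /signed_sum !big_set0 !addr0.
rewrite avgU1 // big_setU1 //=.
have -> : avg M (fun T => (c + signed_sum (i |: M) a T) ^+ 2)
    = (c - a i) ^+ 2 + \sum_(j in M) a j ^+ 2.
  rewrite -IH; apply: eq_avg => T TM; rewrite (signed_sumU1 a iM TM); congr (_ ^+ 2); ring.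
have -> : avg M (fun T => (c + signed_sum (i |: M) a (i |: T)) ^+ 2)
    = (c + a i) ^+ 2 + \sum_(j in M) a j ^+ 2.
  rewrite -IH; apply: eq_avg => T TM; rewrite (signed_sumU1 a iM TM); congr (_ ^+ 2); ring.
by field.
Qed.

(** The argument of Latala and Oleszkiewicz.  The function f = |z|, with z the
    signed sum, is even, so its first-level coefficients vanish, and the
    spectral gap is 2.  By the triangle inequality, the sum of f over the
    neighbours of T is at least (|M| - 2) f(T), so that the Dirichlet form of f
    is at most E f^2.  Hence 2 (E f^2 - (E f)^2) <= E f^2. *)
Lemma khintchine_sqr M a :
  \sum_(j in M) a j ^+ 2 <= 2 * avg M (fun T => `|signed_sum M a T|) ^+ 2.
Proof.
pose f T := `|signed_sum M a T|.
have f2 : avg M (fun T => f T ^+ 2) = \sum_(j in M) a j ^+ 2.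
  have := avg_signed_sqr M a 0; rewrite expr2 mul0r add0r => <-; apply: eq_avg => T _.
  by rewrite add0r real_normK ?num_real.
have level1 j : j \in M -> avg M (fun T => f T * sgn j T) = 0.
  move=> jM; have : avg M (fun T => f T * sgn j T) = - avg M (fun T => f T * sgn j T).
    rewrite -{1}avg_compl -mulN1r -avgZ; apply: eq_avg => T _.
    rewrite /f signed_sum_compl normrN /sgn in_setD jM andbT.
    by case: (j \in T) => /=; ring.
  lra.
have dir : dirichlet M f <= avg M (fun T => f T ^+ 2).
  have -> : dirichlet M f = (#|M|%:R * avg M (fun T => f T ^+ 2)
     - avg M (fun T => f T * \sum_(j in M) f (flip j T))) / 2.
    rewrite /dirichlet.
    have -> : \sum_(j in M) avg M (fun T => (f T - f (flip j T)) ^+ 2) =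
      \sum_(j in M) (2 * avg M (fun T => f T ^+ 2)
          - 2 * avg M (fun T => f T * f (flip j T))).
      apply: eq_bigr => j jM.
      have := avg_flip (fun T => f T ^+ 2) jM => e.
      have -> : 2 * avg M (fun T => f T ^+ 2)
          = avg M (fun T => f T ^+ 2) + avg M (fun T => f (flip j T) ^+ 2).
        by rewrite e; ring.
      rewrite -avgD -avgZ -avgB; apply: eq_avg => T _; ring.
    rewrite sumrB sumr_const -mulr_sumr -avg_sum -mulr_natl.
    have -> : avg M (fun T => \sum_(j in M) f T * f (flip j T)) =
       avg M (fun T => f T * \sum_(j in M) f (flip j T)).
      by apply: eq_avg => T _; rewrite mulr_sumr.
    by field.
  have : (#|M|%:R - 2) * avg M (fun T => f T ^+ 2)
      <= avg M (fun T => f T * \sum_(j in M) f (flip j T)).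
    rewrite -avgZ; apply: le_avg => T _.
    have f0 : 0 <= f T by exact: normr_ge0.
    rewrite expr2 mulrCA ler_wpM2l //.
    have flips : \sum_(j in M) signed_sum M a (flip j T) = (#|M|%:R - 2) * signed_sum M a T.
      transitivity (\sum_(j in M) (signed_sum M a T
          - 2 * (if j \in T then a j else - a j))).
        by apply: eq_bigr => j jM; rewrite signed_sum_flip.
      by rewrite sumrB sumr_const -mulr_sumr -/(signed_sum M a T) -mulr_natl; ring.
    apply: le_trans (ler_norm_sum _ _ _).
    rewrite flips normrM /f ler_wpM2r //; exact: ler_norm.
  lra.
have := poincare_level2 M f.
rewrite big1 ?addr0; last by move=> j jM; rewrite level1 // expr0n.
move: dir; rewrite -/f f2; lra.
Qed.

Lemma khintchine M a :
  Num.sqrt (\sum_(j in M) a j ^+ 2) <= Num.sqrt 2 * avg M (fun T => `|signed_sum M a T|).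
Proof.
have a0 : 0 <= avg M (fun T => `|signed_sum M a T|) by apply: avg_ge0.
rewrite -[avg M _]ger0_norm // -sqrtr_sqr -sqrtrM //.
by rewrite ler_wsqrtr // khintchine_sqr.
Qed.
End Average.

(** * Signed sums with the signs of a Polya urn *)

Section Urn.
Variables (R : rcfType) (V : finType).
Implicit Types (F Q T : {set V}) (i j u : V) (a : V -> R) (c : R).

(** The Beta integral of p^i (1 - p)^j over [0, 1]: the probability that a set
    whose size is uniform on 0, ..., i + j and which is uniform given its size
    is a given set of size i. *)
Definition urn_prob (i j : nat) : R := (i`! * j`!)%:R / (i + j).+1`!%:R.

Lemma urn_prob_ge0 (i j : nat) : 0 <= urn_prob i j.
Proof. by rewrite /urn_prob divr_ge0. Qed.

Lemma urn_probC (i j : nat) : urn_prob i j = urn_prob j i.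
Proof. by rewrite /urn_prob mulnC addnC. Qed.

Lemma urn_probS (i j : nat) : (i + j + 2)%:R * urn_prob i.+1 j = i.+1%:R * urn_prob i j.
Proof.
have fE : (i.+1 + j).+1`! = ((i + j).+2 * (i + j).+1`!)%N by [].
have iE : i.+1`! = (i.+1 * i`!)%N by [].
rewrite /urn_prob fE iE; move: ((i + j).+1`!) (fact_gt0 (i + j).+1) => d' d'0.
rewrite !natrM addn2.
have e0 : (i + j).+2%:R != 0 :> R by rewrite pnatr_eq0.
have d0 : d'%:R != 0 :> R by rewrite pnatr_eq0 -lt0n.
have cancel (e d s x y : R) : e != 0 -> d != 0 -> e * (s * x * y / (e * d))
    = s * (x * y / d).
  by move=> ? ?; field; apply/andP.
exact: cancel.
Qed.

Definition mixed_abs F a c : R := avg F (fun A => `|c + signed_sum F a A|).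

(** The expectation of |z_F + z_Q|, where z_F has independent fair signs and z_Q
    the signs of a Polya urn. *)
Definition energy F Q a : R :=
  \sum_(T : {set V} | T \subset Q) urn_prob #|T| #|Q :\: T| * mixed_abs F a
      (signed_sum Q a T).

Definition merge a u j : V -> R := fun i => if i == j then a j + a u else a i.

Lemma mixed_absU1 F u a c : u \notin F ->
  mixed_abs (u |: F) a c = (mixed_abs F a (c - a u) + mixed_abs F a (c + a u)) / 2.
Proof.
move=> uF; rewrite /mixed_abs avgU1 //; congr ((_ + _) / _); apply: eq_avg => A AF.
  by rewrite (signed_sumU1 a uF AF); congr `| _ |; ring.
by rewrite (signed_sumU1 a uF AF); congr `| _ |; ring.
Qed.

Lemma mixed_abs_merge F u j a c : j \notin F -> mixed_abs F (merge a u j) c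
    = mixed_abs F a c.
Proof.
move=> jF; apply: eq_avg => A _; congr `| _ + _ |; apply: eq_bigr => i iF.
by rewrite /merge; have -> : (i == j) = false by apply: contraNF jF => /eqP <-.
Qed.

Lemma signed_sum_merge Q u j a T : j \in Q ->
  signed_sum Q (merge a u j) T = signed_sum Q a T + (if j \in T then a u else - a u).
Proof.
move=> jQ; rewrite /signed_sum (bigD1 j) //= [in RHS](bigD1 j) //= /merge eqxx.
have -> : \sum_(i in Q | i != j) (if i \in T then if i == j then a j + a u else a i
       else - (if i == j then a j + a u else a i)) =
  \sum_(i in Q | i != j) (if i \in T then a i else - a i).
  by apply: eq_bigr => i /andP[_ /negbTE ->].
by case: (j \in T); ring.
Qed.

(** The urn scheme for the sign of u: given the signs of Q, the sign of u is a
    fair coin with weight 2 or a copy of the sign of some j in Q, each with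
    weight 1.  A copy of the sign of j merges u with j. *)
Lemma energy_rec F Q u a : u \notin Q -> u \notin F -> [disjoint F & Q] ->
  (#|Q| + 2)%:R * energy F (u |: Q) a =
  2 * energy (u |: F) Q a + \sum_(j in Q) energy F Q (merge a u j).
Proof.
move=> uQ uF FQ; rewrite {1}/energy sum_subsetU1 //.
rewrite /energy exchange_big /= 2!mulr_sumr -big_split /=; apply: eq_bigr => T TQ.
have uT : u \notin T by apply: contra uQ => /(subsetP TQ).
rewrite mixed_absU1 // !(signed_sumU1 a uQ TQ).
have c1 : #|(u |: Q) :\: T| = #|Q :\: T|.+1.
  have -> : (u |: Q) :\: T = u |: (Q :\: T).
    by apply/setP => i; rewrite !inE; case: eqVneq => // ->; rewrite uT.
  by rewrite cardsU1 in_setD (negbTE uQ) andbF.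
have c2 : #|u |: T| = #|T|.+1 by rewrite cardsU1 uT.
have c3 : #|(u |: Q) :\: (u |: T)| = #|Q :\: T|.
  congr #|pred_of_set _|; apply/setP => i; rewrite !inE.
  by case: eqVneq => [->|_] //=; rewrite (negbTE uQ) andbF.
have cQ : #|Q| = (#|T| + #|Q :\: T|)%N.
  by rewrite -(cardsID T Q) (setIidPr TQ).
rewrite c1 c2 c3.
set z := signed_sum Q a T; set Kp := mixed_abs F a (z + a u);
    set Km := mixed_abs F a (z - a u).
have -> : \sum_(j in Q) urn_prob #|T| #|Q :\: T| * mixed_abs F (merge a u j)
    (signed_sum Q (merge a u j) T)
  = urn_prob #|T| #|Q :\: T| * (#|T|%:R * Kp + #|Q :\: T|%:R * Km).
  rewrite -mulr_sumr; congr (_ * _).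
  rewrite (bigID (fun j => j \in T)) /=; congr (_ + _).
    rewrite (eq_bigl (fun j => j \in T)); last first.
      by move=> j /=; apply: andb_idl => /(subsetP TQ).
    rewrite mulr_natl -sumr_const; apply: eq_bigr => j jT; have jQ := subsetP TQ j jT.
    rewrite mixed_abs_merge ?signed_sum_merge ?jT //.
    by apply: contraL jQ => jF; rewrite (disjointFr FQ).
  rewrite (eq_bigl (fun j => j \in Q :\: T)); last by move=> j /=; rewrite in_setD andbC.
  rewrite mulr_natl -sumr_const; apply: eq_bigr => j; rewrite in_setD => /andP[jT jQ].
  rewrite mixed_abs_merge ?signed_sum_merge ?(negbTE jT) //.
  by apply: contraL jQ => jF; rewrite (disjointFr FQ).
have b1 : (#|Q| + 2)%:R * urn_prob #|T|.+1 #|Q :\: T|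
    = #|T|.+1%:R * urn_prob #|T| #|Q :\: T|.
  by rewrite cQ urn_probS.
have b2 : (#|Q| + 2)%:R * urn_prob #|T| #|Q :\: T|.+1
    = #|Q :\: T|.+1%:R * urn_prob #|T| #|Q :\: T|.
  by rewrite urn_probC cQ addnC (addnC #|T|) addnC urn_probS
      [urn_prob #|Q :\: T| _]urn_probC.
rewrite [LHS]mulrDr 2!(mulrA (#|Q| + 2)%:R) b1 b2 -!natr1; by field.
Qed.

Definition sqs F a : R := \sum_(j in F) a j ^+ 2.
Definition tot Q a : R := \sum_(j in Q) a j.

Lemma sqs_ge0 F a : 0 <= sqs F a.
Proof. by apply: sumr_ge0 => j _; exact: sqr_ge0. Qed.

Lemma sqs_merge_out F u j a : j \notin F -> sqs F (merge a u j) = sqs F a.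
Proof.
move=> jF; apply: eq_bigr => i iF; rewrite /merge.
by have -> : (i == j) = false by apply: contraNF jF => /eqP <-.
Qed.

Lemma sqs_merge Q u j a : j \in Q -> sqs Q (merge a u j)
    = sqs Q a + 2 * a u * a j + a u ^+ 2.
Proof.
move=> jQ; rewrite /sqs (bigD1 j) //= [in RHS](bigD1 j) //= {1}/merge eqxx.
have -> : \sum_(i in Q | i != j) merge a u j i ^+ 2 = \sum_(i in Q | i != j) a i ^+ 2.
  by apply: eq_bigr => i /andP[_ /negbTE ij]; rewrite /merge ij.
ring.
Qed.

Lemma tot_merge Q u j a : j \in Q -> tot Q (merge a u j) = tot Q a + a u.
Proof.
move=> jQ; rewrite /tot (bigD1 j) //= [in RHS](bigD1 j) //= {1}/merge eqxx.
have -> : \sum_(i in Q | i != j) merge a u j i = \sum_(i in Q | i != j) a i.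
  by apply: eq_bigr => i /andP[_ /negbTE ij]; rewrite /merge ij.
ring.
Qed.

Lemma sqrt_scale (N y : R) : 0 < N ->
  Num.sqrt (4 / 9 * (N + y)) = 2 / 3 * Num.sqrt N * Num.sqrt (1 + y / N).
Proof.
move=> N0; have -> : 4 / 9 * (N + y) = (2 / 3) ^+ 2 * (N * (1 + y / N)) by field; lra.
rewrite sqrtrM ?sqr_ge0 // sqrtr_sqr ger0_norm; last lra.
by rewrite sqrtrM ?ltW // mulrA.
Qed.

(** [merge_step_normalized], rescaled by the root of the old potential. *)
Lemma merge_step Q a (x f : R) (n : nat) :
  #|Q| = n.+2 -> 0 <= f -> (forall j, j \in Q -> `|x| <= `|a j|) ->
  let p := sqs Q a in let S := x + tot Q a in
  (n.+2 + 2)%:R * Num.sqrt (f + 4 / 9 * (x ^+ 2 + p + h_coef n.+1%:R * S ^+ 2)) <=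
  2 * Num.sqrt (f + x ^+ 2 + 4 / 9 * (p + h_coef n%:R * tot Q a ^+ 2)) +
  \sum_(j in Q) Num.sqrt (f + 4 / 9 * (p + 2 * x * a j + x ^+ 2 + h_coef n%:R * S ^+ 2)).
Proof.
move=> cQ f0 small /=; move/eqP: cQ => cQ; set p := sqs Q a; set S := x + tot Q a.
have [k kE] : exists k, n.+1 = k by exists n.+1.
have [m mE] : exists m : R, k%:R = m by exists k%:R.
have m1 : 1 <= m by rewrite -mE -kE ler1n.
have nE : n%:R = m - 1 :> R by rewrite -mE -kE -natr1 addrK.
have hE : h_coef (m - 1) = h_coef m + delta_coef m.
  by rewrite /h_coef /delta_coef; field; apply/andP; split; lra.
have h0 := h_coef_gt0 m1.
have p0 : 0 <= p by exact: sqs_ge0.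
pose N := 9 / 4 * f + x ^+ 2 + p + h_coef m * S ^+ 2.
have N0 : 0 <= N.
  by rewrite /N !addr_ge0 ?sqr_ge0 // mulr_ge0 ?sqr_ge0 //; lra.
have e0 : f + 4 / 9 * (x ^+ 2 + p + h_coef n.+1%:R * S ^+ 2) = 4 / 9 * N.
  by rewrite kE /N mE; field.
have e1 : f + x ^+ 2 + 4 / 9 * (p + h_coef n%:R * tot Q a ^+ 2) =
  4 / 9 * (N + (delta_coef m * S ^+ 2 + mu_coef m * x ^+ 2 - nu_coef m * x * S)).
  rewrite nE.
  have -> : tot Q a = S - x by rewrite /S; ring.
  by rewrite /N /nu_coef /mu_coef /delta_coef /h_coef /eta_coef; field; apply/andP; split;
      lra.
have e2 : \sum_(j in Q) Num.sqrt (f + 4 / 9 * (p + 2 * x * a j + x ^+ 2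
    + h_coef n%:R * S ^+ 2)) =
  \sum_(j in Q) Num.sqrt (4 / 9 * (N + (delta_coef m * S ^+ 2 + 2 * x * a j))).
  by apply: eq_bigr => j _; congr Num.sqrt; rewrite nE hE /N; field.
rewrite e0 e1 e2.
have [NE|Npos] := eqVneq N 0.
  rewrite {1}NE mulr0 sqrtr0 mulr0; apply: addr_ge0; first by rewrite mulr_ge0 ?sqrtr_ge0.
  by apply: sumr_ge0 => j _; exact: sqrtr_ge0.
have {N0}Npos : 0 < N by rewrite lt_neqAle eq_sym Npos.
have -> : Num.sqrt (4 / 9 * N) = 2 / 3 * Num.sqrt N.
  by rewrite -[X in 4 / 9 * X]addr0 sqrt_scale // mul0r addr0 sqrtr1 mulr1.
rewrite sqrt_scale //.
under eq_bigr => j _ do rewrite sqrt_scale //.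
rewrite -mulr_sumr.
set s := Num.sqrt N.
have s0 : 0 < s by rewrite sqrtr_gt0.
have s2 : s ^+ 2 = N by rewrite sqr_sqrtr ?ltW.
have := @merge_step_normalized R V Q (fun j => a j / s) (x / s) n.
rewrite /= kE mE.
have -> : x / s + \sum_(j in Q) a j / s = S / s by rewrite -mulr_suml -mulrDl.
have -> : \sum_(j in Q) (a j / s) ^+ 2 = p / N.
  by rewrite /p /sqs mulr_suml; apply: eq_bigr => j _; rewrite expr_div_n s2.
rewrite !expr_div_n s2 => H.
have {}H : m + 3 <= 2 * Num.sqrt (1 + (delta_coef m * S ^+ 2 + mu_coef m * x ^+ 2
    - nu_coef m * x * S) / N) +
   \sum_(j in Q) Num.sqrt (1 + (delta_coef m * S ^+ 2 + 2 * x * a j) / N).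
  have -> : (delta_coef m * S ^+ 2 + mu_coef m * x ^+ 2 - nu_coef m * x * S) / N =
    delta_coef m * (S ^+ 2 / N) + mu_coef m * (x ^+ 2 / N) - nu_coef m * (x / s) * (S / s).
    by rewrite -s2; field; lra.
  set L := m + 3 in H *; rewrite !addrA.
  have -> : \sum_(j in Q) Num.sqrt (1 + (delta_coef m * S ^+ 2 + 2 * x * a j) / N) =
    \sum_(j in Q) Num.sqrt (1 + delta_coef m * (S ^+ 2 / N) + 2 * (x / s) * (a j / s)).
    by apply: eq_bigr => j _; congr Num.sqrt; rewrite -s2; field; lra.
  apply: H; first by rewrite -kE; exact/eqP.
    move=> j jQ; rewrite !normrM ler_wpM2r //; exact: small.
  have -> : x ^+ 2 / N + p / N + h_coef m * (S ^+ 2 / N)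
      = (x ^+ 2 + p + h_coef m * S ^+ 2) / N by field; lra.
  by rewrite ler_pdivrMr // mul1r /N; lra.
have c4 : (k.+1 + 2)%:R = m + 3 :> R by rewrite -mE -[RHS]/(k%:R + 3%:R) -natrD; congr _%:R;
    lia.
rewrite c4.
have : 2 / 3 * s * (m + 3) <= 2 / 3 * s *
    (2 * Num.sqrt (1 + (delta_coef m * S ^+ 2 + mu_coef m * x ^+ 2 - nu_coef m * x * S) / N)
    +
   \sum_(j in Q) Num.sqrt (1 + (delta_coef m * S ^+ 2 + 2 * x * a j) / N)).
  by rewrite ler_wpM2l // mulr_ge0 ?ltW //; lra.
lra.
Qed.

(** For at most one element the urn sign is a fair coin, and Khintchine's
    inequality gives f + q. *)
Definition potential n (f q S : R) : R :=
  if n is k.+2 then f + 4 / 9 * (q + h_coef k%:R * S ^+ 2) else f + q.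

(** The induction step with two elements.  The constant 4/9 in the potential
    makes it an equality for f = 0 and x + y = 0. *)
Lemma two_point_bound (f x y : R) : 0 <= f ->
  3 * Num.sqrt (f + 4 / 9 * (x ^+ 2 + y ^+ 2 + h_coef 0 * (x + y) ^+ 2)) <=
  2 * Num.sqrt (f + x ^+ 2 + y ^+ 2) + Num.sqrt (f + (x + y) ^+ 2).
Proof.
move=> f0.
have -> : h_coef 0 = 17 / 18 :> R by rewrite /h_coef add0r divr1; field.
set A := f + x ^+ 2 + y ^+ 2; set B := f + (x + y) ^+ 2.
have x20 := sqr_ge0 x; have y20 := sqr_ge0 y; have xy0 := sqr_ge0 (x + y);
    have xmy := sqr_ge0 (x - y).
have A0 : 0 <= A by rewrite /A; lra.
have B0 : 0 <= B by rewrite /B; lra.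
have sA := sqrtr_ge0 A; have sB := sqrtr_ge0 B.
have sA2 : Num.sqrt A ^+ 2 = A by rewrite sqr_sqrtr.
have sB2 : Num.sqrt B ^+ 2 = B by rewrite sqr_sqrtr.
have prod : f + (x + y) ^+ 2 * (25 / 36) <= Num.sqrt A * Num.sqrt B.
  rewrite -sqrtrM //; apply: sqrt_ge.
  have : A >= f + (x + y) ^+ 2 / 2 by rewrite /A; lra.
  move=> hA; apply: le_trans (_ : (f + (x + y) ^+ 2 / 2) * B <= _);
      last by rewrite ler_wpM2r.
  rewrite /B; set t := (x + y) ^+ 2 in xy0 *; nra.
rewrite -[leLHS]ger0_norm ?mulr_ge0 ?sqrtr_ge0 // -[leRHS]ger0_norm ?addr_ge0 ?mulr_ge0 //.
rewrite -ler_sqr ?nnegrE ?normr_ge0 // !real_normK ?num_real // exprMn sqr_sqrtr;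
    last first.
  by lra.
rewrite [leRHS]sqrrD exprMn sA2 sB2 /A /B; move: prod; lra.
Qed.

(** Induction on the urn: the identity [energy_rec] for an element u of minimal
    absolute value and the step inequality for the potential.  When Q is empty
    this is Khintchine's inequality. *)
Lemma energy_lower_bound Q F a : [disjoint F & Q] ->
  Num.sqrt (potential #|Q| (sqs F a) (sqs Q a) (tot Q a)) <= Num.sqrt 2 * energy F Q a.
Proof.
move: {2}#|Q| (erefl #|Q|) => n; elim: n Q F a => [|n IH] Q F a cQ FQ.
  move/eqP: (cQ); rewrite cards_eq0 => /eqP Q0.
  rewrite cQ /= /energy Q0 (big_pred1 set0); last by move=> T; rewrite subset0.
  rewrite setD0 cards0 /urn_prob fact0 addn0 factS fact0 divr1 mul1r.
  rewrite /sqs big_set0 addr0 /signed_sum big_set0 /mixed_abs.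
  apply: le_trans (khintchine F a) _; rewrite ler_wpM2l ?sqrtr_ge0 //.
  by rewrite le_eqVlt; apply/orP; left; apply/eqP; apply: eq_avg => A _; rewrite add0r.
have [i0 i0Q] : exists i, i \in Q by apply/set0Pn; rewrite -card_gt0 cQ.
case: (@arg_minP _ _ _ i0 (fun i => i \in Q) (fun i => `|a i|) i0Q) => u uQ umin.
pose Q' := Q :\ u.
have uQ' : u \notin Q' by rewrite setD11.
have QE : Q = u |: Q' by rewrite setD1K.
have cQ' : #|Q'| = n by move: cQ; rewrite (cardsD1 u) uQ => -[].
have uF : u \notin F by apply: contraL uQ => uF; rewrite (disjointFr FQ).
have FQ' : [disjoint F & Q'] by apply: disjointWr FQ; exact: subD1set.
have jF j : j \in Q' -> j \notin F.
  by move=> jQ; apply: contraL jQ => jF; rewrite (disjointFr FQ').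
have uFQ' : [disjoint u |: F & Q'].
  by rewrite disjoints_subset subUset sub1set inE uQ' -disjoints_subset.
have rec := energy_rec a uQ' uF FQ'; rewrite -QE cQ' in rec.
have sF : sqs (u |: F) a = a u ^+ 2 + sqs F a by rewrite /sqs big_setU1.
have sQ : sqs Q a = a u ^+ 2 + sqs Q' a by rewrite QE /sqs big_setU1.
have tQ : tot Q a = a u + tot Q' a by rewrite QE /tot big_setU1.
have IH1 := IH Q' (u |: F) a cQ' uFQ'; rewrite cQ' sF in IH1.
have IH2 j : j \in Q' -> Num.sqrt (potential n (sqs F a)
    (sqs Q' a + 2 * a u * a j + a u ^+ 2) (tot Q' a + a u))
    <= Num.sqrt 2 * energy F Q' (merge a u j).
  by move=> jQ; have := IH Q' F (merge a u j) cQ' FQ';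
      rewrite cQ' sqs_merge_out ?jF // sqs_merge // tot_merge.
have f0 := sqs_ge0 F a.
have n0 : 0 < (n + 2)%:R :> R by rewrite ltr0n addn2.
rewrite -(ler_pM2l n0) mulrCA rec mulrDr mulrCA cQ sQ tQ.
apply: le_trans (_ : _ <= 2 * Num.sqrt (potential n (a u ^+ 2 + sqs F a) (sqs Q' a)
    (tot Q' a)) +
   \sum_(j in Q') Num.sqrt (potential n (sqs F a) (sqs Q' a + 2 * a u * a j + a u ^+ 2)
       (tot Q' a + a u))) _; last first.
  apply: lerD; last by rewrite mulr_sumr; apply: ler_sum => j jQ; exact: IH2.
  by rewrite ler_wpM2l.
case: n cQ' {IH IH1 IH2 n0 rec cQ} => [|[|n]] cQ'.
- move/eqP: (cQ'); rewrite cards_eq0 => /eqP ->.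
  by rewrite big_set0 addr0 /= /sqs big_set0 !addr0 add0n addrC.
- have /cards1P[v Q'E] : #|Q'| == 1%N by rewrite cQ'.
  rewrite Q'E /tot /sqs !big_set1 /=.
  rewrite -/(sqs F a).
  have := two_point_bound (a u) (a v) f0.
  have -> : sqs F a + (a v ^+ 2 + 2 * a u * a v + a u ^+ 2) = sqs F a + (a u + a v) ^+ 2
      by ring.
  have -> : a u ^+ 2 + sqs F a + a v ^+ 2 = sqs F a + a u ^+ 2 + a v ^+ 2 by ring.
  by [].
- rewrite /=.
  have := @merge_step Q' a (a u) (sqs F a) n cQ' f0.
  have small j : j \in Q' -> `|a u| <= `|a j|.
    by move=> jQ; apply: umin; move: jQ; rewrite in_setD1 => /andP[].
  move=> /(_ small) /=.
  rewrite (addrC (sqs F a) (a u ^+ 2)) (addrC (a u) (tot Q' a)).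
  by [].
Qed.

(** The expected absolute score of a vertex, if Q is the set of the other
    vertices and a its row of net weights: T is the set of later vertices. *)
Definition adaptive_gain Q a : R :=
  \sum_(T : {set V} | T \subset Q) urn_prob #|T| #|Q :\: T| * `|\sum_(j in T) a j|.

(** T and its complement have the same law, so the triangle inequality bounds
    the gain by half the expectation of |a(T) - a(Q - T)|, an energy with empty
    F. *)
Lemma adaptive_gain_ge Q a :
  Num.sqrt 2 / 6 * Num.sqrt (\sum_(j in Q) a j ^+ 2) <= adaptive_gain Q a.
Proof.
have e1 : 1 / 2 * energy set0 Q a <= adaptive_gain Q a.
  have ef T : mixed_abs set0 a (signed_sum Q a T) = `|signed_sum Q a T|.
    by rewrite /mixed_abs avg0 /signed_sum big_set0 addr0.
  have Tsum T : T \subset Q -> \sum_(j in T) a j - \sum_(j in Q :\: T) a j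
      = signed_sum Q a T.
    move=> TQ; rewrite /signed_sum [RHS](bigID (fun j => j \in T)) /=; congr (_ + _).
      rewrite [RHS](eq_bigl (fun j => j \in T)); last first.
        by move=> j /=; apply: andb_idl => /(subsetP TQ).
      by apply: eq_bigr => j ->.
    rewrite -sumrN [RHS](eq_bigl (fun j => j \in Q :\: T));
        last by move=> j /=; rewrite in_setD andbC.
    by apply: eq_bigr => j; rewrite in_setD => /andP[/negbTE -> _].
  have sym : adaptive_gain Q a = \sum_(T : {set V} | T \subset Q) urn_prob #|T| #|Q
      :\: T| * `|\sum_(j in Q :\: T) a j|.
    rewrite /adaptive_gain.
    rewrite (reindex_onto (fun T => Q :\: T) (fun T => Q :\: T)) /=; last first.
      by move=> T TM; rewrite setDDr setDv set0U; apply/setIidPr.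
    apply: eq_big => T; first by rewrite subsetDl /= setDDr setDv set0U;
        apply/eqP/idP => /setIidPr.
    by move=> /andP[_ /eqP ->]; rewrite urn_probC.
  have -> : adaptive_gain Q a = 1 / 2 * (adaptive_gain Q a + adaptive_gain Q a) by field.
  rewrite ler_wpM2l //; first lra.
  rewrite {2}sym -big_split /=; apply: ler_sum => T TQ.
  rewrite -mulrDr ler_wpM2l ?urn_prob_ge0 // ef -Tsum //.
  exact: ler_normB.
have e2 : 2 / 3 * Num.sqrt (\sum_(j in Q) a j ^+ 2) <= Num.sqrt 2 * energy set0 Q a.
  apply: le_trans (energy_lower_bound a _); last by rewrite disjoints_subset sub0set.
  have -> : 2 / 3 * Num.sqrt (\sum_(j in Q) a j ^+ 2) = Num.sqrt (4 / 9 * sqs Q a).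
    have -> : 4 / 9 = (2 / 3) ^+ 2 :> R by field.
    by rewrite sqrtrM ?sqr_ge0 // sqrtr_sqr ger0_norm //; lra.
  apply: ler_wsqrtr; have -> : sqs set0 a = 0 by rewrite /sqs big_set0.
  have q0 := sqs_ge0 Q a.
  case: #|Q| => [|[|n]]; rewrite /= add0r; try lra.
  rewrite ler_wpM2l //; first lra.
  rewrite lerDl mulr_ge0 ?sqr_ge0 // /h_coef.
  have : 0 <= 4 / 9 / (n%:R + 1) :> R by rewrite divr_ge0 // ?addr_ge0 //; lra.
  lra.
have s2 : Num.sqrt 2 * Num.sqrt 2 = 2 :> R by rewrite -expr2 sqr_sqrtr.
have s20 : 0 <= Num.sqrt 2 :> R by exact: sqrtr_ge0.
move: e2; move/(ler_wpM2l s20); rewrite [leRHS]mulrA s2.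
move: e1; set x := energy _ _ _; set y := Num.sqrt (\sum_(j in Q) _) ;
    set g := adaptive_gain _ _.
lra.
Qed.
End Urn.

(** * The greedy arrangement of a random order *)

Section GainRec.
Variables (R : rcfType) (V : finType).
Implicit Types (Q X T : {set V}).

Lemma urn_probS_r (t s : nat) : (t + s).+1%:R * urn_prob R t s
    = if s is s'.+1 then s%:R * urn_prob R t s' else 1.
Proof.
case: s => [|s].
  rewrite addn0 /urn_prob addn0 fact0 muln1.
  have -> : t.+1`! = (t.+1 * t`!)%N by [].
  have t0 : t`!%:R != 0 :> R by rewrite pnatr_eq0 -lt0n fact_gt0.
  have t1 : t.+1%:R != 0 :> R by rewrite pnatr_eq0.
  by rewrite natrM; move: t`!%:R t.+1%:R t0 t1 => x y x0 y0; field; apply/andP.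
by rewrite urn_probC [urn_prob R t s]urn_probC -urn_probS; congr (_%:R * _); lia.
Qed.

(** Conditioning on the first of the |Q| + 1 vertices in the random order: with
    probability 1/(|Q| + 1) it is the vertex itself, whose later vertices are
    then all of Q. *)
Lemma adaptive_gain_rec Q (a : V -> R) :
  #|Q|.+1%:R * adaptive_gain Q a =
  `|\sum_(j in Q) a j| + \sum_(w in Q) adaptive_gain (Q :\ w) a.
Proof.
rewrite /adaptive_gain mulr_sumr.
rewrite (exchange_big_dep (fun T : {set V} => T \subset Q)) /=; last first.
  by move=> w T wQ /subset_trans; apply; exact: subD1set.
rewrite [LHS](bigD1 Q) //= [in RHS](bigD1 Q) //= addrA; congr (_ + _).
  rewrite setDv cards0 mulrA.
  have := urn_probS_r #|Q| 0; rewrite addn0 => ->; rewrite mul1r.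
  rewrite [X in _ = _ + X]big1 ?addr0 // => w /andP[wQ].
  by rewrite subsetD1 wQ andbF.
apply: eq_bigr => T /andP[TQ TnQ].
have cQ : #|Q| = (#|T| + #|Q :\: T|)%N by rewrite -(cardsID T Q) (setIidPr TQ).
have s0 : (0 < #|Q :\: T|)%N.
  rewrite card_gt0; apply: contra TnQ; rewrite setD_eq0 => QT.
  by rewrite eqEsubset TQ.
rewrite [RHS](eq_bigl (fun w => w \in Q :\: T)); last first.
  by move=> w; rewrite subsetD1 TQ !inE andbC.
have e w : w \in Q :\: T -> #|Q :\ w :\: T| = #|Q :\: T|.-1.
  move=> wQT; rewrite (cardsD1 w (Q :\: T)) wQT /=; congr #|pred_of_set _|.
  by apply/setP => i; rewrite !inE; case: (i \in T); case: (i \in Q); case: (i == w).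
rewrite [RHS](eq_bigr (fun w => urn_prob R #|T| #|Q :\: T|.-1 * `|\sum_(j in T) a j|));
    last first.
  by move=> w /e ->.
rewrite sumr_const mulrA cQ urn_probS_r; case: #|Q :\: T| s0 => // s _.
by rewrite -mulrA mulr_natl.
Qed.

Definition total_gain (a : V -> V -> R) X : R := \sum_(v in X) adaptive_gain (X :\ v) (a v).

(** The recursion for the expected gain of the greedy procedure on X, whose
    first vertex v is uniform in X. *)
Lemma total_gain_rec a X :
  #|X|%:R * total_gain a X =
  \sum_(v in X) (`|\sum_(u in X :\ v) a v u| + total_gain a (X :\ v)).
Proof.
rewrite big_split /= /total_gain mulr_sumr.
rewrite (eq_bigr (fun v => `|\sum_(u in X :\ v) a v u|
    + \sum_(w in X :\ v) adaptive_gain (X :\ v :\ w) (a v))); last first.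
  by move=> v vX; rewrite -adaptive_gain_rec (cardsD1 v X) vX.
rewrite big_split /=; congr (_ + _).
rewrite (exchange_big_dep (fun w => w \in X)) /=; last by move=> v w _ /setD1P[].
apply: eq_bigr => w wX; apply: eq_big => [v|v /andP[vX wv]].
  by rewrite !in_setD1 wX andbT eq_sym andbC.
congr adaptive_gain; apply/setP => i; rewrite !inE.
by case: (i == v); case: (i == w).
Qed.
End GainRec.

Section Arrange.
Variables (R : rcfType) (V : finType) (a : V -> V -> R).
Hypothesis anti : forall u v, a u v = - a v u.
Implicit Types (s r A : seq V).

Fixpoint arrange s : seq V :=
  if s is v :: r then
    if 0 <= \sum_(u <- r) a v u then v :: arrange r else rcons (arrange r) v
  else [::].

Fixpoint gain s : R := if s is v :: r then \sum_(u <- r) a v u + gain r else 0.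

Fixpoint greedy_gain s : R :=
  if s is v :: r then `|\sum_(u <- r) a v u| + greedy_gain r else 0.

Lemma perm_arrange s : perm_eq (arrange s) s.
Proof.
elim: s => //= v r IH; case: ifP => _; first by rewrite perm_cons.
by rewrite perm_rcons perm_cons.
Qed.

Lemma gain_rcons r v : gain (rcons r v) = gain r + \sum_(u <- r) a u v.
Proof.
elim: r => [|x r IH] /=; first by rewrite !big_nil.
by rewrite IH big_rcons big_cons /= [X in X + _]addrC; ring.
Qed.

Lemma gain_arrange s : gain (arrange s) = greedy_gain s.
Proof.
elim: s => //= v r IH; have perm := perm_arrange r.
case: leP => h /=.
  by rewrite (perm_big _ perm) /= IH ger0_norm.
rewrite gain_rcons IH (perm_big _ perm) /= addrC; congr (_ + _).
by rewrite ltr0_norm // -sumrN; apply: eq_bigr => u _; exact: anti.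
Qed.

Lemma gain_index s : uniq s ->
  \sum_(x <- s) \sum_(y <- s) (if (index x s < index y s)%N then a x y else 0) = gain s.
Proof.
elim: s => [|v r IH] /=; first by rewrite big_nil.
case/andP=> vr ur; rewrite big_cons big_cons /= eqxx ltnn add0r; congr (_ + _).
  apply: eq_big_seq => y yr.
  by have -> : (v == y) = false by apply: contraNF vr => /eqP ->.
rewrite -IH //; apply: eq_big_seq => x xr; rewrite big_cons eqxx ltn0 add0r.
have nv z : z \in r -> (v == z) = false by move=> zr; apply: contraNF vr => /eqP ->.
by apply: eq_big_seq => y yr; rewrite !nv.
Qed.

Section Orders.
Variable x0 : V.

(** A step of the Fisher-Yates shuffle: entry j leaves, and the last entry takes
    its place. *)
Definition swap_out A j : seq V :=
  [seq nth x0 A (if i == j then (size A).-1 else i) | i <- iota 0 (size A).-1].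

Lemma size_swap_out A j : size (swap_out A j) = (size A).-1.
Proof. by rewrite size_map size_iota. Qed.

Lemma perm_swap_out A j : (j < size A)%N -> perm_eq (nth x0 A j :: swap_out A j) A.
Proof.
move=> jA; rewrite -[X in perm_eq _ X](mkseq_nth x0) /mkseq.
rewrite /swap_out.
have -> : [seq nth x0 A (if i == j then (size A).-1 else i) | i <- iota 0 (size A).-1] =
  map (nth x0 A) [seq (if i == j then (size A).-1 else i) | i <- iota 0 (size A).-1].
  by rewrite -map_comp.
rewrite -map_cons; apply: perm_map; apply: uniq_perm.
- rewrite /= map_inj_in_uniq ?iota_uniq ?andbT.
    apply/mapP => -[i]; rewrite mem_iota => iA; case: eqVneq => [ij|/negP];
        last by move=> h /esym/eqP.
    by move: iA => /=; lia.
  move=> i i'; rewrite !mem_iota /= => iA i1A.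
  by case: (eqVneq i j) => [->|ij]; case: (eqVneq i' j) => [->|ij'] //; lia.
- exact: iota_uniq.
- move=> i; rewrite in_cons mem_iota /=; apply/orP/idP => [[/eqP -> //|/mapP[i']]|iA].
    by rewrite mem_iota /= => i1A ->; case: ifP => _; lia.
  case: (eqVneq i j) => ij; [by left | right].
  apply/mapP; case: (eqVneq i (size A).-1) => iE.
    exists j; first by rewrite mem_iota; move/eqP: ij; lia.
    by rewrite eqxx.
  exists i; first by rewrite mem_iota; move/eqP: iE; lia.
  by rewrite (negbTE ij).
Qed.

(** The in-place version: exchanging entry j with the last entry of A, where Q
    is the part of the array that is already shuffled. *)
Lemma nth_swap_out A Q j p : (j < size A)%N ->
  nth x0 (swap_out A j ++ nth x0 A j :: Q) p =
  if p == (size A).-1 then nth x0 A j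
  else if p == j then nth x0 A (size A).-1 else nth x0 (A ++ Q) p.
Proof.
move=> jA; rewrite nth_cat size_swap_out.
case: (ltngtP p (size A).-1) => [plt|pgt|->]; last by rewrite subnn.
  have pA : (p < size A)%N by lia.
  rewrite (nth_map 0%N) ?size_iota // nth_iota // add0n.
  by case: eqVneq => // _; rewrite nth_cat pA.
have -> : (p == j) = false by apply/eqP; lia.
have Ap : (size A <= p)%N by lia.
rewrite nth_cat ltnNge Ap /=.
by have -> : (p - (size A).-1 = (p - size A).+1)%N by lia.
Qed.

(** The shuffle driven by the digits of m in the factorial base. *)
Fixpoint order_of k A m : seq V :=
  if k is k'.+1 then
    nth x0 A (m %/ k'`!)%N :: order_of k' (swap_out A (m %/ k'`!)%N) (m %% k'`!)%N
  else [::].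

Lemma perm_order_of k A m : size A = k -> (m < k`!)%N -> perm_eq (order_of k A m) A.
Proof.
elim: k A m => [|k IH] A m sA mk /=; first by rewrite (size0nil sA).
have jA : (m %/ k`! < size A)%N by rewrite sA ltn_divLR ?fact_gt0 // -factS.
apply: perm_trans (perm_swap_out jA); rewrite perm_cons.
by apply: IH; rewrite ?size_swap_out ?sA // ltn_mod fact_gt0.
Qed.

Lemma sum_divmod (T : zmodType) (F : nat -> nat -> T) k K : (0 < K)%N ->
  \sum_(0 <= m < k * K) F (m %/ K)%N (m %% K)%N = \sum_(0 <= j < k) \sum_(0 <= i < K) F j i.
Proof.
move=> K0; elim: k => [|k IH]; first by rewrite mul0n !big_geq.
rewrite mulSn addnC (@big_cat_nat _ _ _ (k * K)) //=; last exact: leq_addr.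
rewrite big_nat_recr //= -IH; congr (_ + _).
rewrite -{1}[(k * K)%N]add0n big_addn addKn !big_mkord; apply: eq_bigr => i _.
by rewrite addnC divnMDl // modnMDl divn_small // addn0 modn_small.
Qed.

(** The average over m of the greedy gain obeys the recursion [total_gain_rec],
    since the first digit of m chooses the first vertex. *)
Lemma sum_orders k A : uniq A -> size A = k ->
  \sum_(0 <= m < k`!) greedy_gain (order_of k A m) = k`!%:R * total_gain a [set x in A].
Proof.
elim: k A => [|k IH] A uA sA.
  by rewrite big_nat1 /= (size0nil sA) /total_gain big1 ?mulr0 // => v; rewrite inE.
pose F j i := greedy_gain (nth x0 A j :: order_of k (swap_out A j) i).
rewrite (eq_bigr (fun m => F (m %/ k`!)%N (m %% k`!)%N)) //.
rewrite factS sum_divmod ?fact_gt0 //.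
have cA : #|[set x in A]| = k.+1 by rewrite cardsE (card_uniqP uA).
rewrite natrM (mulrC k.+1%:R) -mulrA.
have := total_gain_rec a [set x in A]; rewrite cA => ->.
transitivity (\sum_(0 <= j < k.+1) k`!%:R *
    (`|\sum_(u in [set x in A] :\ nth x0 A j) a (nth x0 A j) u|
    + total_gain a ([set x in A] :\ nth x0 A j))).
  rewrite !big_mkord; apply: eq_bigr => j _.
  have jA : (j < size A)%N by rewrite sA.
  have perm := perm_swap_out jA.
  have uS : uniq (nth x0 A j :: swap_out A j) by rewrite (perm_uniq perm).
  have [vS uS'] := andP uS.
  have setE : [set x in A] :\ nth x0 A j = [set x in swap_out A j].
    apply/setP => x; rewrite !inE -(perm_mem perm) in_cons.
    by case: eqVneq => //= ->; apply/esym/negbTE.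
  rewrite setE mulrDr.
  have sS : size (swap_out A j) = k by rewrite size_swap_out sA.
  rewrite -(IH _ uS' sS) /F /= big_split /=; congr (_ + _).
  rewrite -{2}[k`!]subn0 mulr_natl -sumr_const_nat; apply: eq_big_nat => i /andP[_ ik].
  rewrite (perm_big _ (perm_order_of sS ik)) /= big_uniq //=; congr `| _ |.
  by apply: eq_bigl => u; rewrite inE.
rewrite -mulr_sumr; congr (_ * _); rewrite -sA.
rewrite -(big_nth x0 predT (fun v => `|\sum_(u in [set x in A] :\ v) a v u|
    + total_gain a ([set x in A] :\ v))).
by rewrite big_uniq //; apply: eq_bigl => u; rewrite inE.
Qed.
End Orders.
End Arrange.

From mathcomp Require Import all_classical all_reals all_analysis.

Local Open Scope classical_set_scope.
Local Open Scope ring_scope.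

(** * From orderings to arc sets *)

Section Graph.
Context {R : realType} {V : finType}.
Variable D : wograph R V.
Implicit Types (s : seq V) (u v : V).

Definition arc_weight u v : R := if (u, v) \in arcs D then weight D (u, v) else 0.

Definition net_weight u v : R := arc_weight u v - arc_weight v u.

Lemma net_weight_anti u v : net_weight u v = - net_weight v u.
Proof. by rewrite /net_weight opprB. Qed.

Lemma sum_arcs (P : V * V -> bool) (f : V * V -> R) :
  \sum_(e in arcs D | P e) f e =
  \sum_u \sum_v (if ((u, v) \in arcs D) && P (u, v) then f (u, v) else 0).
Proof. by rewrite pair_big -big_mkcond /=; apply: eq_big => [[u v]|[u v]]. Qed.

Lemma sum_ordering s (F : V -> R) : is_ordering s -> \sum_v F v = \sum_(v <- s) F v.
Proof.
case=> us sV; rewrite [RHS]big_uniq //=; apply: eq_bigl => v.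
by rewrite sV.
Qed.

Lemma wsum_fwd_back s : is_ordering s ->
  wsum D (fwd D s) - wsum D (back D s) = gain net_weight s.
Proof.
move=> os; have [us _] := os.
have sumE (P : V * V -> bool) : wsum D [set e in arcs D | P e] =
   \sum_u \sum_v (if P (u, v) then arc_weight u v else 0).
  rewrite /wsum (eq_bigl (fun e => (e \in arcs D) && P e)); last by move=> e; rewrite inE.
  rewrite sum_arcs; apply: eq_bigr => u _; apply: eq_bigr => v _.
  by rewrite /arc_weight; case: ((u, v) \in arcs D); case: (P (u, v)).
rewrite !sumE [X in _ - X]exchange_big /= -sumrB -(gain_index net_weight us).
rewrite (sum_ordering _ os); apply: eq_bigr => u _.
rewrite -sumrB (sum_ordering _ os); apply: eq_bigr => v _.
by rewrite /net_weight; case: ifP => _; rewrite ?subrr.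
Qed.

(** A loopless arc is either forward or backward. *)
Lemma wsum_fwdD_back s : is_ordering s ->
  wsum D (fwd D s) + wsum D (back D s) = wsum D (arcs D).
Proof.
case=> us sV; rewrite /wsum.
pose up (e : V * V) := (index e.1 s < index e.2 s)%N.
rewrite [RHS](bigID up) /= /up.
congr (_ + _); apply: eq_bigl => -[u v]; rewrite inE //=.
apply: andb_id2l => uv; rewrite -leqNgt [RHS]leq_eqVlt.
rewrite (inj_in_eq (@index_inj _ u _)) //; try exact: sV.
by case: eqVneq => // vu; move: uv; rewrite vu (negbTE (arcs_loopless D u)).
Qed.

Lemma feedback_back s : is_ordering s -> feedback_arc_set D (back D s).
Proof.
case=> us sV; split; first by apply/fintype.subsetP => e; rewrite inE => /andP[].
have up u v : (u, v) \in arcs D :\: back D s -> (index u s < index v s)%N.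
  rewrite !inE /= => /andP[nb uv]; move: nb; rewrite uv /= -leqNgt leq_eqVlt => /orP[|//].
  rewrite (inj_in_eq (@index_inj _ u _)) //; try exact: sV.
  by move/eqP => vu; move: uv; rewrite vu (negbTE (arcs_loopless D v)).
case=> // x p /andP[cyc _]; exfalso; move: cyc => /= px.
have : path (fun u v => (index u s < index v s)%N) x (rcons p x).
  by apply: sub_path px => u v; exact: up.
have tr : transitive (fun u v => (index u s < index v s)%N)
    by move=> u v w; exact: ltn_trans.
move/(order_path_min tr)/allP => /(_ x); rewrite mem_rcons mem_head => /(_ isT).
by rewrite ltnn.
Qed.

(** As there are no directed 2-cycles, at most one of the two arc weights that
    enter a net weight is nonzero. *)
Lemma w2_net_weight v :
  w2 D v = Num.sqrt (\sum_(u in [set: V] :\ v) net_weight v u ^+ 2).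
Proof.
rewrite /w2; congr Num.sqrt.
rewrite sum_arcs.
have -> : \sum_x \sum_y (if ((x, y) \in arcs D) && incident (x, y) v then weight D
    (x, y) ^+ 2 else 0) =
  \sum_x \sum_y ((if x == v then arc_weight v y ^+ 2 else 0)
      + (if y == v then arc_weight x v ^+ 2 else 0)).
  apply: eq_bigr => x _; apply: eq_bigr => y _; rewrite /incident /= /arc_weight.
  case: eqVneq => [->|xv]; case: eqVneq => [->|yv] /=;
      rewrite ?andbT ?andbF ?addr0 ?add0r //.
  - by rewrite (negbTE (arcs_loopless D v)) expr0n addr0.
  - by case: ifP; rewrite ?expr0n.
  - by case: ifP; rewrite ?expr0n.
under eq_bigr => x _ do rewrite big_split /=.
rewrite big_split /= exchange_big /=.
under eq_bigr => y _ do rewrite -big_mkcond big_pred1_eq.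
under [X in _ + X]eq_bigr => x _ do rewrite -big_mkcond big_pred1_eq.
rewrite -big_split /= [RHS]big_mkcond /=; apply: eq_bigr => u _.
rewrite !inE andbT /net_weight /arc_weight.
case: eqVneq => [->|uv] /=; first by rewrite (negbTE (arcs_loopless D v)) expr0n addr0.
case: ifP => vu; last by rewrite expr0n add0r sub0r sqrrN.
by rewrite (negbTE (arcs_oriented vu)) expr0n addr0 subr0.
Qed.

Lemma mean_gain_ge :
  Num.sqrt 2 / 6 * \sum_v w2 D v <= total_gain net_weight [set: V].
Proof.
rewrite mulr_sumr /total_gain [leRHS](eq_bigl predT); last by move=> v; rewrite inE.
by apply: ler_sum => v _; rewrite w2_net_weight; exact: adaptive_gain_ge.
Qed.

(** Cauchy-Schwarz over the at most Delta arcs at v. *)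
Lemma incident_weight_le v :
  (\sum_(e in arcs D | incident e v) weight D e) <= Num.sqrt (maxdeg D)%:R * w2 D v.
Proof.
set P := fun e => (e \in arcs D) && incident e v.
have cardP : (#|[set e | P e]%SET| <= maxdeg D)%N.
  apply: leq_trans (_ : degree D v <= _)%N; last by rewrite /maxdeg (leq_bigmax v).
  rewrite /degree -cardsUI; apply: leq_trans (leq_addr _ _).
  apply: subset_leq_card; apply/fintype.subsetP => e.
  by rewrite !inE /P /incident => /andP[-> /=].
have S0 : 0 <= \sum_(e | P e) weight D e.
  by apply: sumr_ge0 => e /andP[eD _]; exact: weight_ge0.
rewrite /w2 -sqrtrM ?ler0n // -/(P _).
apply: sqrt_ge.
have Q0 : 0 <= \sum_(e | P e) weight D e ^+ 2 by apply: sumr_ge0 => e _; exact: sqr_ge0.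
apply: le_trans (_ : #|[set e | P e]%SET|%:R * (\sum_(e | P e) weight D e ^+ 2) <= _);
    last first.
  by rewrite ler_wpM2r // ler_nat.
set S := \sum_(e | P e) weight D e; set Q := \sum_(e | P e) _; set N := #|_|%:R.
have N0 : 0 <= N by rewrite ler0n.
(* Expanding this sum of squares gives N Q >= S^2. *)
have : 0 <= \sum_(e | P e) (N * weight D e - S) ^+ 2
    by apply: sumr_ge0 => e _; exact: sqr_ge0.
have -> : \sum_(e | P e) (N * weight D e - S) ^+ 2 = N * (N * Q - S ^+ 2).
  have -> : \sum_(e | P e) (N * weight D e - S) ^+ 2 =
     \sum_(e | P e) (N ^+ 2 * weight D e ^+ 2 - (2 * N * S) * weight D e + S ^+ 2).
    by apply: eq_bigr => e _; ring.
  rewrite big_split sumrB /= sumr_const -!mulr_sumr -/Q -/S.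
  have -> : #|P| = #|[set e | P e]%SET| by apply: eq_card => e; rewrite inE.
  by rewrite -[S ^+ 2 *+ _]mulr_natl -/N; ring.
have [NE|Npos] := eqVneq N 0.
  move=> _; have : #|[set e | P e]%SET| == 0%N by rewrite -(@eqr_nat R) -/N NE.
  rewrite cards_eq0 => /eqP P0.
  rewrite NE mul0r /S big_pred0 ?expr0n // => e.
  by have := finset.in_set0 e; rewrite -P0 inE.
by rewrite pmulr_rge0 ?subr_ge0 // lt_neqAle eq_sym Npos.
Qed.

Lemma sum_incident_weight : \sum_v \sum_(e in arcs D | incident e v) weight D e
    = 2 * wsum D (arcs D).
Proof.
rewrite (exchange_big_dep (fun e => e \in arcs D)) /=; last by move=> v e _ /andP[].
rewrite /wsum mulr_sumr; apply: eq_bigr => -[x y] xy.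
rewrite (eq_bigl (fun v => v \in [set x; y]%SET)); last first.
  by move=> v; rewrite xy /incident !inE /= ![v == _]eq_sym.
have xNy : x != y by apply: contraTneq xy => ->; exact: arcs_loopless.
by rewrite sumr_const cards2 xNy mulr_natl.
Qed.

Lemma sum_w2_ge : (1 <= maxdeg D)%N ->
  2 * wsum D (arcs D) / Num.sqrt (maxdeg D)%:R <= \sum_v w2 D v.
Proof.
move=> d1; have d0 : 0 < Num.sqrt (maxdeg D)%:R :> R by rewrite sqrtr_gt0 ltr0n.
rewrite ler_pdivrMr // -sum_incident_weight [leRHS]mulrC mulr_sumr.
by apply: ler_sum => v _; exact: incident_weight_le.
Qed.

End Graph.

(** * A random order from one uniform real number *)

Section Digit.
Variable R : realType.
Implicit Types (x : R) (N K k i j : nat).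

(** On [0, 1] the minimum only matters at x = 1. *)
Definition digit N x : nat := minn (Num.truncn (N%:R * x)) N.-1.

Lemma digit_lt N x : (0 < N)%N -> (digit N x < N)%N.
Proof. by move=> N0; rewrite /digit (leq_ltn_trans (geq_minr _ _)) // ltn_predL. Qed.

Lemma digit_le N x : 0 <= x -> (digit N x)%:R <= N%:R * x.
Proof.
move=> x0; have Nx : 0 <= N%:R * x by rewrite mulr_ge0.
by rewrite -truncn_ge_nat // geq_minl.
Qed.

Lemma le_digit N x i : 0 <= x -> (i <= digit N x)%N = (i <= N.-1)%N && (i%:R <= N%:R * x).
Proof.
move=> x0; have Nx : 0 <= N%:R * x by rewrite mulr_ge0.
by rewrite /digit leq_min truncn_ge_nat // andbC.
Qed.

Lemma digitP N x i : (i < N)%N -> 0 <= x -> i%:R <= N%:R * x ->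
  (N%:R * x < i.+1%:R) \/ i = N.-1 -> digit N x = i.
Proof.
move=> iN x0 le lt; apply/eqP; rewrite eqn_leq le_digit // le andbT.
have -> : (i <= N.-1)%N by lia.
rewrite andbT leqNgt le_digit // negb_and.
by case: lt => [lt| ->]; [rewrite -ltNge lt orbT | rewrite ltnn].
Qed.

Lemma digit_lastP N x : (0 < N)%N -> 0 <= x ->
  (N%:R * x < (digit N x).+1%:R) \/ digit N x = N.-1.
Proof.
move=> N0 x0; have [lt|ge] := ltnP (digit N x) N.-1; last first.
  by right; have := digit_lt x N0; lia.
left; rewrite ltNge; apply/negP => h.
have : ((digit N x).+1 <= digit N x)%N by rewrite le_digit // h lt.
by rewrite ltnn.
Qed.

Lemma digit_rest N x : (0 < N)%N -> 0 <= x <= 1 -> 0 <= N%:R * x - (digit N x)%:R <= 1.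
Proof.
move=> N0 /andP[x0 x1]; rewrite subr_ge0 digit_le //=.
case: (digit_lastP N0 x0) => [/ltW|->]; first by rewrite -natr1 lerBlDl.
rewrite lerBlDl natr1 prednK //.
by rewrite -[leRHS]mulr1 ler_wpM2l.
Qed.

(** Mixed radix: the leading digit of x in base k, followed by the digit in base
    K of the remainder.  At the right end [x = 1] all digits are maximal. *)
Lemma digit_mul k K x : (0 < k)%N -> (0 < K)%N -> 0 <= x <= 1 ->
  digit (k * K) x = (digit k x * K + digit K (k%:R * x - (digit k x)%:R))%N.
Proof.
move=> k0 K0 x01; have /andP[x0 x1] := x01.
have /andP[y0 y1] := digit_rest k0 x01.
set j := digit k x in y0 y1 *; set y := k%:R * x - j%:R in y0 y1 *.
have jk : (j < k)%N by exact: digit_lt.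
have iK := digit_lt y K0; set i := digit K y in iK *.
have E : (k * K)%:R * x = (j * K)%:R + K%:R * y.
  by rewrite /y !natrM; ring.
apply: digitP => //.
- by apply: leq_trans (_ : j.+1 * K <= _)%N; rewrite ?leq_mul2r ?jk ?orbT // mulSn; lia.
- by rewrite E natrD lerD2l digit_le.
rewrite E; case: (digit_lastP K0 y0) => [lt|iE].
  by left; rewrite -addnS natrD ltrD2l.
case: (digit_lastP k0 x0) => [lt|jE].
  left; rewrite -addnS natrD ltrD2l /i iE prednK //.
  rewrite -[ltRHS]mulr1 ltr_pM2l ?ltr0n // /y ltrBlDl natr1 //.
right; rewrite /i iE /j jE.
rewrite -[in RHS](prednK k0) mulSn /=; lia.
Qed.
End Digit.

Section OrderOfReal.
Variables (R : realType) (V : finType) (x0 : V).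

Fixpoint order_of_real k (A : seq V) (x : R) : seq V :=
  if k is k'.+1 then
    nth x0 A (digit k x) ::
      order_of_real k' (swap_out x0 A (digit k x)) (k%:R * x - (digit k x)%:R)
  else [::].

Lemma order_of_realE k A x : 0 <= x <= 1 ->
  order_of_real k A x = order_of x0 k A (digit k`! x).
Proof.
elim: k A x => [|k IH] A x x01 //=.
rewrite IH ?digit_rest // factS digit_mul ?fact_gt0 //.
by rewrite divnMDl ?fact_gt0 // modnMDl divn_small ?digit_lt ?fact_gt0 // addn0 modn_small
    ?digit_lt ?fact_gt0.
Qed.
End OrderOfReal.

Section Expectation.
Variables (R : realType) (d : measure_display) (Omega : measurableType d).
Variables (P : probability Omega R) (U : nat -> {RV P >-> R}).
Hypothesis iidU : iid_uniform01 U.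

Lemma uniform_prob_itv (a b : R) (c : bool) : 0 <= a -> a < b -> b <= 1 ->
  uniform_prob (@ltr01 R) [set` Interval (BLeft a) (BSide c b)] = (b - a)%:E.
Proof.
move=> a0 ab b1; rewrite /uniform_prob.
rewrite (eq_integral (fun=> 1%E)); last first.
  move=> x; rewrite inE /= => xab; rewrite /uniform_pdf subr0 invr1.
  have -> : 0 <= x <= 1; last by [].
  have /andP[ax xb] : a <= x <= b.
    by move: xab; case: c; rewrite in_itv //= => /andP[-> /ltW].
  by rewrite (le_trans a0 ax) (le_trans xb b1).
rewrite integral_cst //= mul1e lebesgue_measure_itv /= lte_fin ab.
by rewrite EFinB.
Qed.

Lemma mem_itv_bool (a b x : R) (c : bool) :
  (x \in Interval (BLeft a) (BSide c b)) = (a <= x) && (if c then x < b else x <= b).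
Proof. by case: c; rewrite in_itv. Qed.

(** The last of the N intervals of length 1/N also contains its right end, the
    value 1. *)
Lemma digit_event N m : (m < N)%N ->
  [set omega | digit N (U 0%N omega) = m] =
  U 0%N @^-1` [set` Interval (BLeft (m%:R / N%:R)) (BSide (m != N.-1) (m.+1%:R / N%:R))].
Proof.
move=> mN; have N0 : 0 < N%:R :> R by rewrite ltr0n; lia.
have N0' : (0 < N)%N by lia.
case: iidU => U01 _ _.
apply/seteqP; split => omega /=; have /andP[u0 u1] := U01 0%N omega;
    set u := U 0%N omega in u0 u1 *.
  move=> dE; rewrite mem_itv_bool; apply/andP; split.
    by rewrite ler_pdivrMr // mulrC -dE digit_le.
  case: eqVneq => [mE|mN1] /=.
    rewrite mE prednK // divff ?gt_eqF //.
  rewrite ltr_pdivlMr // mulrC -dE.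
  by case: (digit_lastP N0' u0) => // h; rewrite -dE h eqxx in mN1.
rewrite mem_itv_bool => /andP[le lt].
rewrite ler_pdivrMr // mulrC in le.
apply: digitP => //; case: eqVneq lt => [mE|mN1] /= lt; [by right|left].
by rewrite ltr_pdivlMr // mulrC in lt.
Qed.

Lemma measurable_digit N m : measurable [set omega | digit N (U 0%N omega) = m].
Proof.
have [mN|Nm] := ltnP m N.
  rewrite digit_event // -[X in measurable X]setTI.
  exact: measurable_funPT.
have [N0|N0] := posnP N.
  have [m0|m0] := eqVneq m 0%N.
    rewrite (_ : [set _ | _] = setT); first exact: measurableT.
    by apply/seteqP; split => // omega _ /=; rewrite /digit N0 m0 minn0.
  rewrite (_ : [set _ | _] = set0); first exact: measurable0.
  by apply/seteqP; split => // omega /=; rewrite /digit N0 minn0 => /esym/eqP;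
      rewrite (negbTE m0).
rewrite (_ : [set _ | _] = set0); first exact: measurable0.
by apply/seteqP; split => // omega /= dE; have := digit_lt (U 0%N omega) N0; rewrite dE;
    lia.
Qed.

Lemma prob_digit N m : (m < N)%N -> P [set omega | digit N (U 0%N omega) = m]
    = (N%:R^-1)%:E.
Proof.
move=> mN; rewrite digit_event //.
have N0 : 0 < N%:R :> R by rewrite ltr0n; lia.
case: iidU => _ dist _.
have mI : measurable ([set` Interval (BLeft (m%:R / N%:R))
    (BSide (m != N.-1) (m.+1%:R / N%:R))] : set R).
  exact: measurable_itv.
have := dist 0%N _ mI; rewrite /distribution /pushforward /= => ->.
rewrite uniform_prob_itv.
- by congr EFin; rewrite -mulrBl -natr1 addrC addKr mul1r.
- by rewrite divr_ge0.
- by rewrite ltr_pM2r ?invr_gt0 // ltr_nat.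
- by rewrite ler_pdivrMr // mul1r ler_nat.
Qed.

(** The random variable is a finite combination of indicators of digit events. *)
Lemma expectation_digit N (c : nat -> R) : (0 < N)%N ->
  ('E_P[fun omega => c (digit N (U 0%N omega))] = ((\sum_(0 <= m < N) c m) / N%:R)%R%:E)%E.
Proof.
move=> N0; pose E m := [set omega | digit N (U 0%N omega) = m].
pose X m : Omega -> R := c m \o* \1_(E m).
have mE m : measurable (E m) by exact: measurable_digit.
have iE m : (\1_(E m) : Omega -> R) \in Lfun P 1.
  by apply/Lfun1_integrable; exact: integrable_indic.
have XE : (fun omega => c (digit N (U 0%N omega)))
    = \sum_(Xi <- [seq X m | m <- index_iota 0 N]) Xi.
  apply/funext => omega; rewrite fct_sumE big_map.
  have dN := digit_lt (U 0%N omega) N0.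
  rewrite (bigD1_seq (digit N (U 0%N omega))) ?iota_uniq ?mem_index_iota //= big1 ?addr0.
    by rewrite /X /= indicE mem_set // mul1r.
  move=> m mN; rewrite /X /= indicE memNset ?mul0r //.
  by move=> /= h; rewrite h eqxx in mN.
rewrite XE expectation_sum; last first.
  move=> Xi /mapP[m _ ->]; exact: Lfun_scale.
rewrite big_map mulr_suml -sumEFin; apply: eq_big_nat => m /andP[_ mN].
by rewrite expectationZl // expectation_indic // prob_digit // EFinM.
Qed.
End Expectation.

(** * The program and its running time *)

Section Hoare.
Variables (R : realType) (u : nat -> R).
Implicit Types (st : state R) (c : cmd) (b : bexp) (Q : state R -> Prop).

(** Total correctness with a time bound. *)
Definition runs c st (T : nat) Q : Prop :=
  exists t st', [/\ exec u c st t st', (t <= T)%N & Q st'].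

Fixpoint loop_free c : bool :=
  match c with
  | Seq c1 c2 | If _ c1 c2 => loop_free c1 && loop_free c2
  | While _ _ => false
  | _ => true
  end.

(** The result of running a loop-free command; loops get a dummy value. *)
Fixpoint eff c st : state R :=
  match c with
  | Skip | While _ _ => st
  | ISet x e => iset st x (ieval st e)
  | IPut a i e => iput st a (ieval st i) (ieval st e)
  | RSet x e => rset st x (reval st e)
  | RPut a i e => rput st a (ieval st i) (reval st e)
  | Sample x => draw u st x
  | Seq c1 c2 => eff c2 (eff c1 st)
  | If b c1 c2 => if beval st b then eff c1 st else eff c2 st
  end.

Fixpoint max_cost c : nat :=
  match c with
  | Skip | While _ _ | Sample _ => 1
  | ISet _ e => (icost e).+1
  | IPut _ i e => (icost i + icost e).+1
  | RSet _ e => (rcost e).+1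
  | RPut _ i e => (icost i + rcost e).+1
  | Seq c1 c2 => (max_cost c1 + max_cost c2)%N
  | If b c1 c2 => ((bcost b).+1 + maxn (max_cost c1) (max_cost c2))%N
  end.

Lemma runs_loop_free c st Q : loop_free c -> Q (eff c st) -> runs c st (max_cost c) Q.
Proof.
move=> lf Qst; suff: exists2 t, exec u c st t (eff c st) & (t <= max_cost c)%N.
  by case=> t et tc; exists t, (eff c st).
elim: c st lf {Qst} => /= [|x e|a i e|x e|a i e|x|c1 IH1 c2 IH2|b c1 IH1 c2 IH2|//] st lf.
- by exists 1%N => //; constructor.
- by eexists; [constructor|].
- by eexists; [constructor|].
- by eexists; [constructor|].
- by eexists; [constructor|].
- by exists 1%N => //; constructor.
- have /andP[l1 l2] := lf.
  have [t1 e1 b1] := IH1 st l1; have [t2 e2 b2] := IH2 (eff c1 st) l2.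
  by exists (t1 + t2)%N; [apply: exec_seq e1 e2 | lia].
- have /andP[l1 l2] := lf.
  have [t1 e1 b1] := IH1 st l1; have [t2 e2 b2] := IH2 st l2.
  case bE : (beval st b); [exists ((bcost b).+1 + t1)%N | exists ((bcost b).+1 + t2)%N];
    by [apply: exec_if; rewrite bE | lia].
Qed.

Lemma runs_seq c1 c2 st T1 T2 Q1 Q :
  runs c1 st T1 Q1 -> (forall st1, Q1 st1 -> runs c2 st1 T2 Q) ->
  runs (Seq c1 c2) st (T1 + T2) Q.
Proof.
move=> [t1 [st1 [e1 b1 /[swap] /[apply] ]]] [t2 [st2 [e2 b2 q2]]].
by exists (t1 + t2)%N, st2; split=> //; [apply: exec_seq e1 e2 | lia].
Qed.

(** The invariant is indexed by the number of completed rounds. *)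
Lemma runs_while b c (I : nat -> state R -> Prop) (f : nat -> nat) N st :
  (forall i st, (i < N)%N -> I i st -> beval st b /\ runs c st (f i) (I i.+1)) ->
  (forall st, I N st -> ~~ beval st b) -> I 0%N st ->
  runs (While b c) st (\sum_(0 <= i < N) ((bcost b).+1 + f i) + (bcost b).+1) (I N).
Proof.
move=> step stop.
suff H k : (k <= N)%N -> forall st, I (N - k)%N st ->
    runs (While b c) st (\sum_(N - k <= i < N) ((bcost b).+1 + f i) + (bcost b).+1) (I N).
  by move=> I0; have := H N (leqnn N) st; rewrite subnn; apply.
elim: k => [|k IH] kN st' Ist.
  rewrite subn0 in Ist *; exists (bcost b).+1, st'; split=> //; last exact: leq_addl.
  by apply: exec_while_stop; exact: stop.
have lt : (N - k.+1 < N)%N by lia.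
have [bt [t1 [st1 [e1 b1 I1]]]] := step _ _ lt Ist.
have E : (N - k.+1).+1 = (N - k)%N by lia.
rewrite E in I1; have [t2 [st2 [e2 b2 I2]]] := IH (ltnW kN) _ I1.
exists ((bcost b).+1 + (t1 + t2))%N, st2; split=> //; first exact: exec_while_step e1 e2.
by rewrite big_ltn // E; lia.
Qed.
End Hoare.

Notation "c1 ;; c2" := (Seq c1 c2) (at level 80, right associativity).

(** Integer variables: 1 is a counter, 2 a bit position, 3 the current digit,
    4 the number of bits, 5 a power of two, 6 a temporary, 7 a list cell, 8 a
    target vertex, 9 and 10 the two ends of the free part of the output.
    Real variables: 0 is the current remainder of the random number, 1 its
    multiple.  Integer arrays: 3 is the output, 4 the array being shuffled, 5
    the positions in it, 6 the powers of two.  Real arrays: 1 holds the scores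
    and 2 the table of the reals 0, ..., n. *)
Definition init_head : cmd :=
  ISet 1 (IConst 0) ;; RPut 2 (IConst 0) (RConst 0).
Definition init_body : cmd :=
  IPut 4 (IVar 1) (IVar 1) ;;
  RPut 1 (IVar 1) (RConst 0) ;;
  RPut 2 (IAdd (IVar 1) (IConst 1)) (RAdd (RGet 2 (IVar 1)) (RConst 1)) ;;
  ISet 1 (IAdd (IVar 1) (IConst 1)).
Definition below_n : bexp := ILe (IAdd (IVar 1) (IConst 1)) (IVar 0).

Definition powers_head : cmd := ISet 4 (IConst 0) ;; ISet 5 (IConst 1).
Definition powers_body : cmd :=
  IPut 6 (IVar 4) (IVar 5) ;; ISet 5 (IAdd (IVar 5) (IVar 5)) ;;
  ISet 4 (IAdd (IVar 4) (IConst 1)).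

(** Binary search for the digit [digit k x]: the candidate is raised by
    decreasing powers of two whenever the result stays below k and does not
    exceed k x. *)
Definition search_head : cmd :=
  RSet 1 (RMul (RGet 2 (IVar 1)) (RVar 0)) ;; ISet 3 (IConst 0) ;; ISet 2 (IVar 4).
Definition search_body : cmd :=
  ISet 2 (ISub (IVar 2) (IConst 1)) ;;
  ISet 6 (IAdd (IVar 3) (IGet 6 (IVar 2))) ;;
  If (BAnd (ILe (IAdd (IVar 6) (IConst 1)) (IVar 1)) (RLe (RGet 2 (IVar 6)) (RVar 1)))
     (ISet 3 (IVar 6)) Skip.

(** The chosen vertex goes to the end of the unshuffled part, and its new position is
    recorded.  The array is thus filled from the right, and contains the random
    order in reverse. *)
Definition swap : cmd :=
  RSet 0 (RSub (RVar 1) (RGet 2 (IVar 3))) ;;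
  ISet 1 (ISub (IVar 1) (IConst 1)) ;;
  ISet 6 (IGet 4 (IVar 3)) ;;
  IPut 4 (IVar 3) (IGet 4 (IVar 1)) ;;
  IPut 4 (IVar 1) (IVar 6) ;;
  IPut 5 (IVar 6) (IVar 1).
Definition positive x : bexp := ILe (IConst 1) (IVar x).

(** An arc from y to x contributes to one score only, that of the end which
    comes first in the random order and hence has the larger position. *)
Definition score_body : cmd :=
  ISet 8 (IGet 2 (IVar 7)) ;;
  If (ILe (IAdd (IGet 5 (IVar 8)) (IConst 1)) (IGet 5 (IVar 1)))
     (RPut 1 (IVar 1) (RAdd (RGet 1 (IVar 1)) (RGet 0 (IVar 7))))
     (RPut 1 (IVar 8) (RSub (RGet 1 (IVar 8)) (RGet 0 (IVar 7)))) ;;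
  ISet 7 (IGet 1 (IVar 7)).

Definition place_head : cmd :=
  ISet 1 (IVar 0) ;; ISet 9 (IConst 0) ;; ISet 10 (IVar 0).
Definition place_body : cmd :=
  ISet 1 (ISub (IVar 1) (IConst 1)) ;;
  ISet 6 (IGet 4 (IVar 1)) ;;
  If (RLe (RConst 0) (RGet 1 (IVar 6)))
     (IPut 3 (IVar 9) (IVar 6) ;; ISet 9 (IAdd (IVar 9) (IConst 1)))
     (ISet 10 (ISub (IVar 10) (IConst 1)) ;; IPut 3 (IVar 10) (IVar 6)).

Definition init_phase : cmd := init_head ;; While below_n init_body.
Definition powers_phase : cmd := powers_head ;; While (ILe (IVar 5) (IVar 0)) powers_body.
Definition shuffle_step : cmd := (search_head ;; While (positive 2) search_body) ;; swap.
Definition shuffle_phase : cmd :=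
  (Sample 0 ;; ISet 1 (IVar 0)) ;; While (positive 1) shuffle_step.
Definition score_step : cmd :=
  (ISet 7 (IGet 0 (IVar 1)) ;; While (positive 7) score_body) ;;
  ISet 1 (IAdd (IVar 1) (IConst 1)).
Definition score_phase : cmd := ISet 1 (IConst 0) ;; While below_n score_step.
Definition place_phase : cmd := place_head ;; While (positive 1) place_body.

Definition program : cmd :=
  init_phase ;; powers_phase ;; shuffle_phase ;; score_phase ;; place_phase.

Section Correct.
Variables (R : realType) (n' : nat).
Let n := n'.+1.
Variables (D : wograph R 'I_n) (st0 : state R) (u : nat -> R).
Hypothesis input0 : input_state D st0.
Hypothesis u01 : 0 <= u 0%N <= 1.
Implicit Types st : state R.

(** The input is never overwritten. *)
Definition keeps st : Prop :=
  [/\ ivar st 0 = n, iarr st 0 = iarr st0 0, iarr st 1 = iarr st0 1,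
      iarr st 2 = iarr st0 2 & rarr st 0 = rarr st0 0].

Definition init_inv i st : Prop :=
  [/\ keeps st, drawn st = 0%N, ivar st 1 = i &
   [/\ forall j, (j < i)%N -> iarr st 4 j = j, forall j, (j < i)%N -> rarr st 1 j = 0
     & forall j, (j <= i)%N -> rarr st 2 j = j%:R]].

Lemma init_correct : exists2 T,
  runs u init_phase st0 T (init_inv n) & (T <= 100 * n.+1)%N.
Proof.
eexists.
  apply: (runs_seq (Q1 := init_inv 0)).
    apply: runs_loop_free => //; have [n0 d0 _] := input0.
    by split=> //; split=> // j; rewrite leqn0 => /eqP ->.
  move=> st1 inv1; apply: (runs_while (f := fun _ => max_cost init_body)) inv1.
    move=> i st iN [[k0 k1 k2 k3 k4] dr iE [h4 h1 h2]]; split.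
      by rewrite /= k0 iE addn1.
    apply: runs_loop_free => //; split=> //=.
      by rewrite /= /upd /= iE addn1.
    split=> j; rewrite /upd /= iE ?ltnS ?addn1.
    - by case: eqVneq => // ji jlt; apply: h4; lia.
    - by case: eqVneq => // ji jlt; apply: h1; lia.
    - case: eqVneq => [->|ji] jlt; first by rewrite h2 // natr1.
      by apply: h2; lia.
  by move=> st [[k0 _ _ _ _] _ iE _]; rewrite /= k0 iE addn1 ltnn.
rewrite big_const_nat iter_addn_0 subn0 /=; lia.
Qed.

Definition ready st : Prop :=
  [/\ keeps st, drawn st = 0%N, forall j, (j < n)%N -> iarr st 4 j = j,
      forall j, (j < n)%N -> rarr st 1 j = 0
    & forall j, (j <= n)%N -> rarr st 2 j = j%:R].

Definition nbits : nat := (trunc_log 2 n).+1.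

Definition powers_inv i st : Prop :=
  [/\ ready st, ivar st 4 = i, ivar st 5 = (2 ^ i)%N
    & forall j, (j < i)%N -> iarr st 6 j = (2 ^ j)%N].

Lemma powers_correct st : init_inv n st ->
  exists2 T, runs u powers_phase st T (powers_inv nbits) & (T <= 100 * nbits.+1)%N.
Proof.
move=> [ks dr _ [h4 h1 h2]]; eexists.
  apply: (runs_seq (Q1 := powers_inv 0)).
    by apply: runs_loop_free => //; split=> //; split.
  move=> st1 inv1; apply: (runs_while (f := fun _ => max_cost powers_body)) inv1.
    move=> i st2 iN [[[k0 k1 k2 k3 k4] dr2 g4 g1 g2] iE pE h6]; split.
      by rewrite /= k0 pE; apply: leq_trans (@trunc_logP 2 n isT isT); rewrite leq_exp2l.
    apply: runs_loop_free => //; split=> //=; rewrite ?/upd /= ?iE ?pE ?addn1 //.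
      by rewrite expnS mul2n addnn.
    move=> j; rewrite ltnS; case: eqVneq => [-> //|ji] jlt; apply: h6; lia.
  move=> st2 [[[k0 _ _ _ _] _ _ _ _] _ pE _]; rewrite /= k0 pE -ltnNge.
  by rewrite /nbits trunc_log_ltn.
rewrite big_const_nat iter_addn_0 subn0 /=; lia.
Qed.

Let v0 : 'I_n := ord0.

(** After i rounds the digit is known up to its lowest [nbits - i] binary
    places. *)
Definition search_inv (st1 : state R) k (x : R) i st : Prop :=
  [/\ [/\ rvar st = rvar st1, iarr st = iarr st1, rarr st = rarr st1 & drawn st
      = drawn st1],
      [/\ ivar st 0 = ivar st1 0, ivar st 1 = ivar st1 1 & ivar st 4 = ivar st1 4],
      ivar st 2 = (nbits - i)%N, (ivar st 3 <= digit k x)%N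
    & (digit k x < ivar st 3 + 2 ^ (nbits - i))%N].

Lemma search_correct st k x :
  (0 < k)%N -> (k <= n)%N -> 0 <= x <= 1 ->
  ivar st 1 = k -> ivar st 4 = nbits -> rvar st 0 = x ->
  (forall j, (j <= n)%N -> rarr st 2 j = j%:R) ->
  (forall j, (j < nbits)%N -> iarr st 6 j = (2 ^ j)%N) ->
  exists2 T, runs u (search_head ;; While (positive 2) search_body) st T
     (fun st' => search_inv (rset st 1 (k%:R * x)) k x nbits st') & (T <= 200 * nbits.+1)%N.
Proof.
move=> k0 kn x01 kE LE xE RT pw; have /andP[x0 x1] := x01; eexists.
  apply: (runs_seq (Q1 := search_inv (rset st 1 (k%:R * x)) k x 0)).
    apply: runs_loop_free => //; split=> //=.
      by rewrite kE xE RT.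
    rewrite /upd /= subn0 add0n; apply: leq_trans (digit_lt x k0) _.
    by apply: leq_trans kn _; apply: ltnW; rewrite /nbits trunc_log_ltn.
  move=> st1 inv1; apply: (runs_while (f := fun _ => max_cost search_body)) inv1.
    move=> i st2 iN [[rv ia ra dr] [i0 i1 i4] i2 lo hi]; split.
      by rewrite /= i2; lia.
    apply: runs_loop_free => //.
    have e2 : (nbits - i)%N = (nbits - i.+1).+1 by lia.
    have pwE : iarr st2 6 (nbits - i.+1) = (2 ^ (nbits - i.+1))%N by rewrite ia pw //; lia.
    have st2E : (ivar st2 2 - 1)%N = (nbits - i.+1)%N by rewrite i2; lia.
    rewrite /= /upd /= st2E pwE i1 /= kE rv ra /= /upd /= addn1.
    set t := (ivar st2 3 + 2 ^ (nbits - i.+1))%N.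
    have tE : (t < k)%N && (rarr st 2 t <= k%:R * x) = (t <= digit k x)%N.
      rewrite le_digit //; have -> : (t < k)%N = (t <= k.-1)%N by lia.
      apply: andb_id2l => tk; rewrite RT //; lia.
    rewrite tE /t; case: ifP => tJ; split=> //=; rewrite /upd /= ?i1 ?kE //.
      by move: hi; rewrite e2 expnS; lia.
    by move: tJ; lia.
  by move=> st2 [_ _ i2 _ _]; rewrite /= i2 subnn.
rewrite big_const_nat iter_addn_0 subn0 /=; lia.
Qed.

Lemma search_result st1 k x st : search_inv st1 k x nbits st -> ivar st 3 = digit k x.
Proof. by case=> _ _ _; rewrite subnn expn0; lia. Qed.

(** After i rounds A is the unshuffled part of the array and Q the shuffled one;
    the part of the random order that is still to come is determined by A and
    the remainder x. *)
Definition shuffle_inv i st : Prop :=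
  exists (A Q : seq 'I_n) (x : R),
  [/\ [/\ keeps st, ivar st 1 = size A, ivar st 4 = nbits & rvar st 0 = x],
      [/\ forall j, (j < n)%N -> rarr st 1 j = 0,
          forall j, (j <= n)%N -> rarr st 2 j = j%:R
        & forall j, (j < nbits)%N -> iarr st 6 j = (2 ^ j)%N],
      [/\ size A = (n - i)%N, 0 <= x <= 1 & perm_eq (A ++ Q) (enum 'I_n)],
      (forall j, (j < n)%N -> iarr st 4 j = nth v0 (A ++ Q) j) /\
      (forall q, q \in Q -> iarr st 5 q = (size A + index q Q)%N)
    & rev (order_of_real v0 n (enum 'I_n) (u 0%N))
        = rev (order_of_real v0 (n - i) A x) ++ Q].

Lemma shuffle_correct st : powers_inv nbits st ->
  exists2 T, runs u shuffle_phase st T (shuffle_inv n) & (T <= n.+1 * (1000 * nbits.+1))%N.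
Proof.
move=> [[ks dr g4 g1 g2] LE _ pw]; have [k0 k1 k2 k3 k4] := ks; eexists.
  apply: (runs_seq (Q1 := shuffle_inv 0)).
    apply: runs_loop_free => //; exists (enum 'I_n), [::], (u 0%N).
    rewrite subn0 !cats0; split=> //=.
    - by split=> //=; rewrite /upd /= ?k0 ?dr // size_enum_ord.
    - by rewrite size_enum_ord; split.
    - by split=> // j jn; rewrite g4 // nth_enum_ord.
  move=> st1 inv1.
  apply: (runs_while (f := fun _ => 200 * nbits.+1 + max_cost swap)%N) inv1.
    move=> i st2 iN [A [Q [x [[ks2 i1 i4 xE] [z RT pw2] [sA x01 perm] [a4 a5] ordE]]]].
    have sA0 : (0 < size A)%N by rewrite sA; lia.
    split; first by rewrite /= i1.
    have sAn : (size A <= n)%N by rewrite sA leq_subr.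
    have [T [t [st3 [e3 b3 inv3]]] TN] := search_correct sA0 sAn x01 i1 i4 xE RT pw2.
    apply: (runs_seq (Q1 := fun st3 => search_inv (rset st2 1 ((size A)%:R * x)) (size A) x
        nbits st3)).
      by exists t, st3; split=> //; apply: leq_trans b3 TN.
    move=> {t st3 e3 b3 inv3 T TN} st3 inv3; have j3 := search_result inv3.
    case: inv3 => [[rv ia ra dr3] [i0 i1' i4'] _ _ _].
    have {}ia : iarr st3 = iarr st2 := ia; have {}ra : rarr st3 = rarr st2 := ra.
    have {}i1' : ivar st3 1 = size A := etrans i1' i1.
    have {}i4' : ivar st3 4 = nbits := etrans i4' i4.
    have {}i0 : ivar st3 0 = ivar st2 0 := i0.
    have {}rv : rvar st3 1 = (size A)%:R * x by rewrite rv.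
    apply: runs_loop_free => //.
    have jA : (digit (size A) x < size A)%N by exact: digit_lt.
    set j := digit (size A) x in j3 jA.
    pose A' := swap_out v0 A j; pose v := nth v0 A j.
    have sA' : size A' = (size A).-1 by rewrite size_swap_out.
    have pA : perm_eq (v :: A') A := perm_swap_out v0 jA.
    have perm' : perm_eq (A' ++ v :: Q) (enum 'I_n).
      by apply: perm_trans perm; rewrite -cat_rcons perm_cat2r perm_rcons.
    have sAQ : size (A ++ Q) = n by rewrite (perm_size perm) size_enum_ord.
    have uAQ : uniq (A' ++ v :: Q) by rewrite (perm_uniq perm') enum_uniq.
    have vQ : v \notin Q by move: uAQ; rewrite cat_uniq /= => /and3P[_ _ /andP[]].
    have [k20 k21 k22 k23 k24] := ks2.
    have dE : (size A - 1)%N = (size A).-1 by rewrite subn1.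
    have readA p : (p < size A)%N -> iarr st2 4 p = nth v0 A p.
      by move=> pA'; rewrite a4 ?nth_cat ?pA' //; exact: leq_trans pA' sAn.
    exists A', (v :: Q), ((size A)%:R * x - j%:R).
    split.
    - split=> //=; rewrite /upd /= ?rv ?ia ?ra ?i0 ?i1' ?i4'.
      + by split; rewrite /= /upd /= ?ia ?ra ?i0.
      + by rewrite dE sA'.
      + by rewrite j3 RT //; apply: leq_trans (ltnW jA) sAn.
    - by split=> //=; rewrite /upd /= ?ra ?ia.
    - split=> //; first by rewrite sA' sA subnS.
      exact: digit_rest.
    - split=> [p pn|q].
        rewrite /= /upd /= ia i1' dE j3 /A' /v (readA j) // (readA (size A).-1)
            ?ltn_predL // a4 // nth_swap_out //.
        by case: ifP => // _; case: ifP.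
      rewrite /= /upd /= ia i1' dE j3 readA // -/v sA' in_cons.
      case: (eqVneq q v) => [->|qv] /=; first by rewrite !eqxx addn0.
      by move=> qQ; rewrite (inj_eq val_inj) (negbTE qv) a5 // -addSnnS prednK.
    - have iE : (n - i)%N = (n - i.+1).+1 by rewrite subnSK.
      have sE : (n - i.+1).+1 = size A by rewrite -iE sA.
      by rewrite ordE iE [order_of_real _ _.+1 _ _]/= sE rev_cons cat_rcons.
  by move=> st2 [A [Q [x [[_ i1 _ _] _ [sA _ _] _ _]]]]; rewrite /= i1 sA subnn.
rewrite big_const_nat iter_addn_0 subn0 /=; nia.
Qed.

Definition final_order : seq 'I_n := order_of_real v0 n (enum 'I_n) (u 0%N).

Arguments final_order : simpl never.

Lemma perm_final_order : perm_eq final_order (enum 'I_n).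
Proof.
rewrite /final_order order_of_realE //; apply: perm_order_of.
  by rewrite size_enum_ord.
by rewrite digit_lt // fact_gt0.
Qed.

Definition shuffled st : Prop :=
  [/\ keeps st, forall j, (j < n)%N -> rarr st 1 j = 0,
      forall j, (j < n)%N -> iarr st 4 j = nth v0 (rev final_order) j
    & forall q : 'I_n, iarr st 5 q = index q (rev final_order)].

Lemma shuffle_inv_end st : shuffle_inv n st -> shuffled st.
Proof.
case=> A [Q [x [[ks _ _ _] [z _ _] [sA _ perm] [a4 a5] ordE]]].
rewrite subnn in sA ordE; move/size0nil: sA => A0; rewrite A0 /= in perm a4 a5 ordE.
have E : rev final_order = Q := ordE.
by rewrite /shuffled E; split=> // q; apply: a5; rewrite (perm_mem perm) mem_enum.
Qed.

(** Ranks are positions in the reversed order, so later vertices have smaller ranks. *)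
Definition rank (v : 'I_n) : nat := index v (rev final_order).

(** Of the two ends of an arc, the one chosen first has the larger rank. *)
Definition score_of_arc (y x z : 'I_n) : R :=
  if (rank x < rank y)%N then (if z == y then weight D (y, x) else 0)
  else (if z == x then - weight D (y, x) else 0).

Definition out_list (v : 'I_n) (l : seq 'I_n) : Prop :=
  [/\ uniq l, forall x, (x \in l) = ((v, x) \in arcs D) &
      linked_list st0 (iarr st0 0 v) [seq (val x, weight D (v, x)) | x <- l]].

Lemma sum_out_list (v : 'I_n) l (F : 'I_n -> R) : out_list v l ->
  \sum_(x <- l) F x = \sum_x (if (v, x) \in arcs D then F x else 0).
Proof.
case=> ul lE _; rewrite big_uniq //= -big_mkcond /=.
by apply: eq_bigl => x; rewrite lE.
Qed.

Lemma size_out_list (v : 'I_n) l : out_list v l -> size l = (\sum_x ((v, x) \in arcs D))%N.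
Proof.
case=> ul lE _; rewrite -(card_uniqP ul) -sum1_card big_mkcond /=.
by apply: eq_bigr => x _; rewrite lE; case: (_ \in arcs D).
Qed.

Lemma linked_list_eq st st1 p l : iarr st 1 = iarr st1 1 -> iarr st 2 = iarr st1 2 ->
  rarr st 0 = rarr st1 0 -> linked_list st p l -> linked_list st1 p l.
Proof.
move=> e1 e2 e3; elim: l p => //= -[x r] l IH p [p0 px pr pl].
by split; rewrite -?e2 -?e3 -?e1 //; exact: IH.
Qed.

Definition score_data st : Prop :=
  [/\ keeps st, forall j, (j < n)%N -> iarr st 4 j = nth v0 (rev final_order) j
    & forall q : 'I_n, iarr st 5 q = rank q].

(** [base] holds the scores before the list of [y] is scanned; the current cell
    is entry i of the list. *)
Definition score_list_inv (y : 'I_n) (l : seq 'I_n) (base : 'I_n -> R) i st : Prop :=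
  [/\ score_data st, ivar st 1 = y,
      linked_list st (ivar st 7) [seq (val x, weight D (y, x)) | x <- drop i l]
    & forall z : 'I_n, rarr st 1 z = base z + \sum_(x <- take i l) score_of_arc y x z].

Lemma score_list_correct (y : 'I_n) l base st : out_list y l -> score_data st -> ivar st 1
    = y ->
  (forall z : 'I_n, rarr st 1 z = base z) ->
  exists2 T, runs u (ISet 7 (IGet 0 (IVar 1)) ;; While (positive 7) score_body) st T
    (score_list_inv y l base (size l)) & (T <= 100 * (size l).+1)%N.
Proof.
move=> [ul lE ll] sd yE z0; eexists.
  apply: (runs_seq (Q1 := score_list_inv y l base 0)).
    apply: runs_loop_free => //; have [[k0 k1 k2 k3 k4] _ _] := sd; split=> //.
      rewrite drop0 /= /upd /= k1 yE; apply: linked_list_eq ll => //=.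
      by move=> z; rewrite /= z0 take0 big_nil addr0.
  move=> st1 inv1; apply: (runs_while (f := fun _ => max_cost score_body)) inv1.
    move=> i st2 iN [[[k0 k1 k2 k3 k4] a4 a5] yE2 ll2 zE].
    rewrite (drop_nth v0) //= in ll2; case: ll2 => p0 px pr ll2.
    split; first by rewrite /=; case: (ivar st2 7) p0.
    apply: runs_loop_free => //.
    set x := nth v0 l i in px pr.
    have tE z : base z + \sum_(x <- take i.+1 l) score_of_arc y x z =
      rarr st2 1 z + score_of_arc y x z.
      by rewrite (take_nth v0) // big_rcons /= zE addrA.
    have test : (iarr st2 5 (iarr st2 2 (ivar st2 7)) + 1 <= iarr st2 5 (ivar st2 1))%N
        = (rank x < rank y)%N.
      by rewrite px yE2 !a5 addn1.
    rewrite /= /upd /= test; case: ifP => lt; split=> //.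
    - by apply: linked_list_eq ll2.
    - move=> z; rewrite tE /= /upd /= yE2 (inj_eq val_inj) /score_of_arc lt.
      by case: eqVneq => [->|_]; rewrite ?addr0 // pr.
    - by apply: linked_list_eq ll2.
    - move=> z; rewrite tE /= /upd /= px (inj_eq val_inj) /score_of_arc lt.
      by case: eqVneq => [->|_]; rewrite ?addr0 // pr.
  by move=> st2 [_ _]; rewrite drop_size /= => ->.
rewrite big_const_nat iter_addn_0 subn0 /=; lia.
Qed.

Definition score_inv (L : 'I_n -> seq 'I_n) i st : Prop :=
  [/\ score_data st, ivar st 1 = i
    & forall z : 'I_n, rarr st 1 z =
        \sum_(y < n | (y < i)%N) \sum_(x <- L y) score_of_arc y x z].

Definition scored st : Prop :=
  [/\ keeps st, forall j, (j < n)%N -> iarr st 4 j = nth v0 (rev final_order) j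
    & forall z : 'I_n, rarr st 1 z = \sum_(x | (rank x < rank z)%N) net_weight D z x].

Lemma rank_inj : injective rank.
Proof.
have mem x : x \in rev final_order by rewrite mem_rev (perm_mem perm_final_order) mem_enum.
by move=> x y; exact: (index_inj v0 (mem x) (mem y)).
Qed.

Lemma total_score z :
  \sum_(y < n) \sum_(x < n) (if (y, x) \in arcs D then score_of_arc y x z else 0) =
  \sum_(x | (rank x < rank z)%N) net_weight D z x.
Proof.
have -> : \sum_(y < n) \sum_(x < n) (if (y, x) \in arcs D then score_of_arc y x z else 0) =
  \sum_(y < n) \sum_(x < n) ((if y == z then
      (if (rank x < rank z)%N then arc_weight D z x else 0) else 0)
     - (if x == z then (if (rank y < rank z)%N then arc_weight D y z else 0) else 0)).
  apply: eq_bigr => y _; apply: eq_bigr => x _;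
      rewrite /score_of_arc /arc_weight ![z == _]eq_sym.
  have [yx|] := boolP ((y, x) \in arcs D); last first.
    move=> nyx; case: (eqVneq y z) => [?|_]; case: (eqVneq x z) => [?|_]; subst;
      by rewrite ?(negbTE nyx) ?if_same ?subrr ?subr0.
  have xNy : x != y by apply: contraTneq yx => ->; exact: arcs_loopless.
  case: (eqVneq y z) => [yz|_]; case: (eqVneq x z) => [xz|_].
  - by rewrite xz yz eqxx in xNy.
  - by rewrite -yz yx subr0; case: ifP.
  - rewrite -xz yx sub0r; case: ltngtP => //; rewrite ?oppr0 //.
    by move/rank_inj => xy; rewrite xy eqxx in xNy.
  - by rewrite subrr; case: ifP.
have sum1 (F : 'I_n -> R) : \sum_(x < n) (if x == z then F x else 0) = F z.
  by rewrite -big_mkcond big_pred1_eq.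
under eq_bigr => y _ do rewrite sumrB (sum1 (fun=> _)).
rewrite sumrB exchange_big /=.
under eq_bigr => x _ do rewrite (sum1 (fun=> _)).
rewrite -sumrB [RHS]big_mkcond /=; apply: eq_bigr => x _.
by case: ifP => _; rewrite ?subrr.
Qed.

Lemma score_correct st : shuffled st ->
  exists2 T, runs u score_phase st T scored & (T <= 1000 * (#|arcs D| + n.+1))%N.
Proof.
move=> [ks z0 a4 a5]; have [n0 d0 lists] := input0.
have [L LP] : exists L : 'I_n -> seq 'I_n, forall y, out_list y (L y).
  exists (fun y => sval (cid (lists y))) => y; exact: svalP (cid (lists y)).
have sd : score_data st by split.
pose Lsize i := size (L (inord i)).
have [T rT TN] : exists2 T, runs u score_phase st T (score_inv L n) &
    (T <= 1000 * (\sum_(0 <= i < n) Lsize i + n.+1))%N.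
  eexists.
    apply: (runs_seq (Q1 := score_inv L 0)).
      apply: runs_loop_free => //; split=> // z; rewrite /= z0 //.
      by rewrite big_pred0.
    move=> st1 inv1.
    apply: (runs_while (f := fun i => 100 * (Lsize i).+1
        + max_cost (ISet 1 (IAdd (IVar 1) (IConst 1))))%N) inv1.
      move=> i st2 iN [sd2 i1 zE].
      have [[k0 _ _ _ _] _ _] := sd2.
      split; first by rewrite /= k0 i1 addn1.
      pose y : 'I_n := inord i; have yE : y = i :> nat by rewrite inordK.
      have i1y : ivar st2 1 = y by rewrite i1 yE.
      have [T [t [st3 [e3 b3 inv3]]] TN] := score_list_correct (LP y) sd2 i1y zE.
      apply: (runs_seq (Q1 := score_list_inv y (L y)
          (fun z => \sum_(y < n | (y < i)%N) \sum_(x <- L y) score_of_arc y x z)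
              (size (L y)))).
        by exists t, st3; split=> //; apply: leq_trans b3 TN.
      move=> st4 [sd4 i4 _ z4]; apply: runs_loop_free => //; split=> //=.
        by rewrite /upd /= i4 yE addn1.
      move=> z; rewrite z4 take_size [RHS](bigD1 y) /=; last by rewrite yE.
      rewrite addrC; congr (_ + _); apply: eq_bigl => y'.
      rewrite -val_eqE /= yE ltnS; lia.
    by move=> st2 [[[k0 _ _ _ _] _ _] i1 _]; rewrite /= k0 i1 addn1 ltnn.
  rewrite big_split /= big_split /= !big_const_nat !iter_addn_0 subn0 /= -big_distrr /=.
  have -> : (\sum_(0 <= i < n) (Lsize i).+1 = \sum_(0 <= i < n) Lsize i + n)%N.
    rewrite -[X in (_ + X)%N]muln1 -[X in (X * _)%N]subn0 -sum_nat_const_nat -big_split /=.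
    by apply: eq_bigr => i _; rewrite addn1.
  lia.
exists T.
  case: rT => t [st' [e b [[ks' a4' _] _ zE]]]; exists t, st'; split=> //; split=> // z.
  rewrite zE -total_score.
  rewrite (eq_bigl predT); last by move=> y; rewrite ltn_ord.
  by apply: eq_bigr => y _; rewrite (sum_out_list _ (LP y)).
have <- : (\sum_(0 <= i < n) Lsize i = #|arcs D|)%N; last exact: TN.
rewrite big_mkord (eq_bigr (fun y : 'I_n => size (L y))); last first.
  by move=> y _; rewrite /Lsize inord_val.
rewrite (eq_bigr (fun y : 'I_n => \sum_(x : 'I_n) ((y, x) \in arcs D))%N); last first.
  by move=> y _; rewrite (size_out_list (LP y)).
rewrite pair_big /= -sum1_card [RHS]big_mkcond /=.
by apply: eq_bigr => -[y x] _ /=; case: (_ \in arcs D).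
Qed.

Definition sigma : seq 'I_n := arrange (net_weight D) final_order.

(** The output array is filled from both ends: Ls and Rs are its final left and
    right parts. *)
Definition place_inv i st : Prop :=
  exists Ls Rs : seq 'I_n,
  [/\ scored st, ivar st 1 = (n - i)%N,
      sigma = Ls ++ arrange (net_weight D) (drop i final_order) ++ Rs,
      [/\ ivar st 9 = size Ls & ivar st 10 = (size Ls + (n - i))%N]
    & (forall j, (j < size Ls)%N -> iarr st 3 j = nth v0 Ls j) /\
      (forall j, (j < size Rs)%N -> iarr st 3 (size Ls + (n - i) + j) = nth v0 Rs j)].

Lemma size_final_order : size final_order = n.
Proof. by rewrite (perm_size perm_final_order) size_enum_ord. Qed.

Lemma uniq_final_order : uniq final_order.
Proof. by rewrite (perm_uniq perm_final_order) enum_uniq. Qed.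

Lemma sum_lower_rank i (F : 'I_n -> R) : (i < n)%N ->
  \sum_(x | (rank x < rank (nth v0 final_order i))%N) F x
      = \sum_(x <- drop i.+1 final_order) F x.
Proof.
move=> iN; have uf := uniq_final_order; have sf := size_final_order.
rewrite [RHS]big_uniq ?drop_uniq //=; apply: eq_bigl => x.
set v := nth v0 final_order i.
have E : rev final_order = rev (drop i.+1 final_order) ++ v :: rev (take i final_order).
  rewrite -{1}(cat_take_drop i final_order) (drop_nth v0) ?sf // rev_cat rev_cons.
  by rewrite cat_rcons.
have uE : uniq (rev final_order) by rewrite rev_uniq.
have vn : v \notin rev (drop i.+1 final_order).
  by move: uE; rewrite E cat_uniq /= => /and3P[_ /norP[]].
rewrite /rank E !index_cat (negbTE vn) /= eqxx addn0 mem_rev.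
case: ifP => xd; last by rewrite ltnNge leq_addr.
by rewrite index_mem mem_rev.
Qed.

Lemma place_correct st : scored st ->
  exists2 T, runs u place_phase st T (place_inv n) & (T <= 100 * n.+1)%N.
Proof.
move=> sc; have [[k0 k1 k2 k3 k4] a4 zE] := sc; eexists.
  apply: (runs_seq (Q1 := place_inv 0)).
    apply: runs_loop_free => //; exists [::], [::]; rewrite drop0 cats0 subn0; split=> //.
  move=> st1 inv1; apply: (runs_while (f := fun _ => max_cost place_body)) inv1.
    move=> i st2 iN [Ls [Rs [sc2 i1 sE i9_10 oL_oR]]]; have [i9 i10] := i9_10;
        have [oL oR] := oL_oR.
    have [[g0 g1 g2 g3 g4] b4 yE] := sc2.
    split; first by rewrite /= i1; lia.
    apply: runs_loop_free => //.
    have sf := size_final_order.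
    set v := nth v0 final_order i.
    have iE : (ivar st2 1 - 1)%N = (n - i.+1)%N by rewrite i1; lia.
    have vE : iarr st2 4 (n - i.+1) = v.
      rewrite b4; last lia.
      by rewrite nth_rev sf; [congr (val (nth _ _ _)); lia | lia].
    have scoreE : rarr st2 1 v = \sum_(x <- drop i.+1 final_order) net_weight D v x.
      by rewrite yE sum_lower_rank.
    rewrite (drop_nth v0) ?sf // -/v /= -scoreE in sE.
    have nE : (n - i)%N = (n - i.+1).+1 by lia.
    rewrite /= /upd /= iE vE; case: ifP sE => side sE.
      exists (rcons Ls v), Rs; split=> //=; rewrite /upd /= ?iE ?size_rcons ?i9 ?i10 //.
      - by rewrite sE cat_rcons.
      - by split; [rewrite addn1 | rewrite nE; lia].
      - split=> j jlt.
          rewrite nth_rcons; case: (ltngtP j (size Ls)) => h //; first by rewrite oL.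
          by move: jlt; rewrite ltnS leqNgt h.
        have -> : (((size Ls).+1 + (n - i.+1) + j)%N == size Ls) = false by apply/eqP; lia.
        by rewrite -oR //; congr (iarr _ _ _); lia.
    exists Ls, (v :: Rs); split=> //=; rewrite /upd /= ?iE ?i9 ?i10 //.
    - by rewrite sE cat_rcons.
    - by split=> //; lia.
    - have rE : (size Ls + (n - i) - 1)%N = (size Ls + (n - i.+1))%N by lia.
      rewrite rE; split=> j jlt.
        have -> : (j == (size Ls + (n - i.+1))%N) = false by apply/eqP; lia.
        exact: oL.
      case: j jlt => [|j] jlt; first by rewrite addn0 eqxx.
      have -> : ((size Ls + (n - i.+1) + j.+1)%N == (size Ls + (n - i.+1))%N) = false
          by apply/eqP; lia.
      by rewrite /= -oR //; congr (iarr _ _ _); lia.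
  by move=> st2 [Ls [Rs [_ i1 _ _ _]]]; rewrite /= i1 subnn.
rewrite big_const_nat iter_addn_0 subn0 /=; lia.
Qed.

Lemma place_inv_output st : place_inv n st -> output_is st sigma.
Proof.
case=> Ls [Rs [_ _ sE _ [oL oR]]]; rewrite drop_oversize ?size_final_order //= in sE.
rewrite subnn addn0 in oR; rewrite /output_is sE.
have sz : size (Ls ++ Rs) = n.
  by rewrite -sE (perm_size (perm_arrange _ _)) size_final_order.
apply: (@eq_from_nth _ 0%N); first by rewrite !size_map size_iota sz.
rewrite size_map size_iota => j jn.
rewrite (nth_map 0%N) ?size_iota // nth_iota // (nth_map v0) ?sz // add0n nth_cat.
case: ltnP => h; first exact: oL.
rewrite -[RHS]oR; first by congr (iarr _ _ _); lia.
by move: sz; rewrite size_cat; lia.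
Qed.

Lemma program_correct : exists2 T, runs u program st0 T (fun st => output_is st sigma) &
  (T <= 3000 * (#|arcs D| + n.+1 * nbits.+1))%N.
Proof.
have [T1 r1 b1] := init_correct.
have [t1 [st1 [e1 c1 q1]]] := r1.
have [T2 [t2 [st2 [e2 c2 q2]]] b2] := powers_correct q1.
have [T3 [t3 [st3 [e3 c3 /shuffle_inv_end q3]]] b3] := shuffle_correct q2.
have [T4 [t4 [st4 [e4 c4 q4]]] b4] := score_correct q3.
have [T5 [t5 [st5 [e5 c5 /place_inv_output q5]]] b5] := place_correct q4.
exists (t1 + (t2 + (t3 + (t4 + t5))))%N.
  exists (t1 + (t2 + (t3 + (t4 + t5))))%N, st5; split=> //.
  by apply: exec_seq e1 _; apply: exec_seq e2 _; apply: exec_seq e3 _; apply: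
      exec_seq e4 e5.
have xp : (n.+1 <= n.+1 * nbits.+1)%N by rewrite leq_pmulr.
have yp : (nbits.+1 <= n.+1 * nbits.+1)%N by rewrite leq_pmull.
have {}b3 : (T3 <= 1000 * (n.+1 * nbits.+1))%N by apply: leq_trans b3 _; rewrite mulnCA.
move: (n.+1 * nbits.+1)%N xp yp b3 => p xp yp b3.
move: c1 c2 c3 c4 c5 b1 b2 b4 b5 xp yp; move: n.+1 nbits.+1 #|arcs D| => x y a.
move=> c1 c2 c3 c4 c5 b1 b2 b4 b5 xp yp; clear -c1 c2 c3 c4 c5 b1 b2 b3 b4 b5 xp yp.
lia.
Qed.
End Correct.

(** * The expected weight of the output *)

(** An arc is not a loop; this ensures that ln n > 0, so that n is absorbed by
    n ln n. *)
Lemma two_vertices (R : realType) n (D : wograph R 'I_n) : (1 <= maxdeg D)%N -> (1 < n)%N.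
Proof.
move=> d1; have [v dv] : exists v, (0 < degree D v)%N.
  apply/existsP; apply: contraLR d1; rewrite negb_exists -leqNgt leqn0 => /forallP d0.
  by rewrite /maxdeg big1 // => v _; apply/eqP; have := d0 v; rewrite -eqn0Ngt.
have [e eD] : exists e, e \in arcs D.
  move: dv; rewrite /degree addn_gt0 !card_gt0.
  by case/orP=> /set0Pn[e]; rewrite inE => /andP[eD _]; exists e.
have : e.1 != e.2 by apply: contraTneq eD; case: e => x y /= ->; exact: arcs_loopless.
have := ltn_ord e.1; have := ltn_ord e.2; rewrite -val_eqE /=; lia.
Qed.

(** This needs n > 1, for otherwise ln n = 0. *)
Lemma nbits_le (R : realType) n' : (1 < n'.+1)%N ->
  (nbits n').+1%:R * ln 2 <= 3 * ln n'.+1%:R :> R.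
Proof.
move=> n1; have l2 : 0 < ln 2 :> R by apply: ln_gt0; rewrite ltr1n.
have l2n : ln 2 <= ln n'.+1%:R :> R by rewrite ler_ln // ?posrE ?ltr0n // ler_nat.
have : (trunc_log 2 n'.+1)%:R * ln 2 <= ln n'.+1%:R :> R.
  rewrite mulr_natl -lnXn // ler_ln ?posrE ?exprn_gt0 ?ltr0n // -natrX ler_nat.
  exact: trunc_logP.
have -> : (nbits n').+1%:R = (trunc_log 2 n'.+1)%:R + 2 :> R by rewrite /nbits -addn2 natrD.
lra.
Qed.

Section RandomOrdering.
Context (R : realType) (n' : nat).
Let n := n'.+1.
Variable D : wograph R 'I_n.

(** The output as a function of the number of the random order. *)
Definition ordering_of (m : nat) : seq 'I_n :=
  arrange (net_weight D) (order_of ord0 n (enum 'I_n) m).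

Lemma sigma_digit (u : nat -> R) : 0 <= u 0%N <= 1 ->
  sigma D u = ordering_of (digit n`! (u 0%N)).
Proof. by move=> u01; rewrite /sigma /final_order order_of_realE. Qed.

Lemma is_ordering_sigma (u : nat -> R) : 0 <= u 0%N <= 1 -> is_ordering (sigma D u).
Proof.
move=> u01; have p := perm_trans (perm_arrange (net_weight D) _) (perm_final_order _ u01).
split; first by rewrite (perm_uniq p) enum_uniq.
by move=> v; rewrite (perm_mem p) mem_enum.
Qed.

Lemma is_ordering_of m : (m < n`!)%N -> is_ordering (ordering_of m).
Proof.
move=> mn; have s : size (enum 'I_n) = n by rewrite size_enum_ord.
have p := perm_trans (perm_arrange (net_weight D) _) (perm_order_of ord0 s mn).
split; first by rewrite (perm_uniq p) enum_uniq.
by move=> v; rewrite (perm_mem p) mem_enum.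
Qed.

Lemma mean_gain :
  (\sum_(0 <= m < n`!) gain (net_weight D) (ordering_of m)) / n`!%:R =
  total_gain (net_weight D) [set: 'I_n]%SET.
Proof.
rewrite (eq_bigr (fun m => greedy_gain (net_weight D) (order_of ord0 n (enum 'I_n) m)));
    last first.
  by move=> m _; apply: gain_arrange; exact: net_weight_anti.
rewrite sum_orders ?enum_uniq ?size_enum_ord // mulrAC divff ?mul1r; last first.
  by rewrite pnatr_eq0 -lt0n fact_gt0.
by congr total_gain; apply/setP => v; rewrite !inE mem_enum.
Qed.

Context (d : measure_display) (Omega : measurableType d).
Variables (P : probability Omega R) (U : nat -> {RV P >-> R}).
Hypothesis iidU : iid_uniform01 U.

Lemma sigma_sample omega :
  sigma D (U ^~ omega) = ordering_of (digit n`! (U 0%N omega)).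
Proof. by apply: sigma_digit; case: iidU. Qed.

Lemma measurable_sigma (s : seq 'I_n) : measurable [set omega | sigma D (U ^~ omega) = s].
Proof.
have -> : [set omega | sigma D (U ^~ omega) = s] =
   \bigcup_(m in [set m | ordering_of m = s]) [set omega | digit n`! (U 0%N omega) = m].
  apply/seteqP; split => omega /=; rewrite sigma_sample.
    by move=> sE; exists (digit n`! (U 0%N omega)).
  by move=> [m /= <- ->].
by apply: bigcup_measurable => m _; exact: measurable_digit.
Qed.

Lemma expectation_sigma (c : seq 'I_n -> R) :
  ('E_P[fun omega => c (sigma D (U ^~ omega))] =
   ((\sum_(0 <= m < n`!) c (ordering_of m)) / n`!%:R)%R%:E)%E.
Proof.
rewrite -(expectation_digit iidU (fun m => c (ordering_of m))) ?fact_gt0 //.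
by congr expectation; apply/funext => omega; rewrite sigma_sample.
Qed.

Lemma expectation_gain :
  ('E_P[fun omega => (wsum D (fwd D (sigma D (U ^~ omega))) -
                      wsum D (back D (sigma D (U ^~ omega))))%R] =
   (total_gain (net_weight D) [set: 'I_n]%SET)%:E)%E.
Proof.
rewrite (expectation_sigma (fun s => wsum D (fwd D s) - wsum D (back D s))) -mean_gain.
congr (_ / _)%:E; apply: eq_big_nat => m /andP[_ mn].
by rewrite wsum_fwd_back //; exact: is_ordering_of.
Qed.

(** By w(fwd) + w(back) = w(D), the backward weight is (w(D) - gain) / 2. *)
Lemma expectation_back :
  ('E_P[fun omega => wsum D (back D (sigma D (U ^~ omega)))] =
   ((wsum D (arcs D) - total_gain (net_weight D) [set: 'I_n]%SET) / 2)%R%:E)%E.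
Proof.
rewrite (expectation_sigma (fun s => wsum D (back D s))) -mean_gain; congr (_%:E).
rewrite (eq_big_nat _ _ (F2 := fun m => (wsum D (arcs D)
    - gain (net_weight D) (ordering_of m)) / 2)); last first.
  move=> m /andP[_ mn]; have o := is_ordering_of mn.
  by rewrite -(wsum_fwd_back D o) -(wsum_fwdD_back D o); field.
rewrite -mulr_suml sumrB sumr_const_nat subn0 -[wsum D (arcs D) *+ _]mulr_natl.
have : n`!%:R != 0 :> R by rewrite pnatr_eq0 -lt0n fact_gt0.
by move: (n`!%:R : R) => F F0; field.
Qed.
End RandomOrdering.

Theorem mainTheorem3 (R : realType) :
  exists (prog : cmd) (C : R),
  forall (n : nat) (D : wograph R 'I_n) (st : state R),
  (1 <= maxdeg D)%N ->
  input_state D st ->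
  exists sigma : (nat -> R) -> seq 'I_n,
  [/\ (* every run halts in time O(a(D) + n log n) and outputs an ordering *)
      forall u : nat -> R, (forall i, 0 <= u i <= 1) ->
        [/\ computes_within u prog st
              (C * (#|arcs D|%:R + n%:R * ln n%:R)) (sigma u),
            is_ordering (sigma u)
          & feedback_arc_set D (back D (sigma u))],
      (* the output is a random ordering with the stated expectations *)
      forall (d : measure_display) (Omega : measurableType d)
             (P : probability Omega R) (U : nat -> {RV P >-> R}),
        iid_uniform01 U ->
        [/\ forall s : seq 'I_n,
              measurable [set omega | sigma (U ^~ omega) = s],
            (((Num.sqrt 2 / 6) * \sum_(v < n) w2 D v)%:E <=
             'E_P[fun omega => (wsum D (fwd D (sigma (U ^~ omega))) -
                                wsum D (back D (sigma (U ^~ omega))))%R])%E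
          & ('E_P[fun omega => wsum D (back D (sigma (U ^~ omega)))] <=
             (wsum D (arcs D) / 2 -
              Num.sqrt 2 / 12 * \sum_(v < n) w2 D v)%:E)%E],
      (Num.sqrt 2 / 6) * \sum_(v < n) w2 D v >=
        Num.sqrt 2 * wsum D (arcs D) / (3 * Num.sqrt (maxdeg D)%:R)
    & wsum D (arcs D) / 2 - Num.sqrt 2 / 12 * \sum_(v < n) w2 D v <=
        (1 / 2 - Num.sqrt 2 / (6 * Num.sqrt (maxdeg D)%:R)) *
          wsum D (arcs D)].
Proof.
have l2 : 0 < ln 2 :> R by apply: ln_gt0; rewrite ltr1n.
(* n + 1 <= 2 n, and the number of bits plus one is at most 3 ln n / ln 2. *)
exists program, (3000 * (1 + 6 / ln 2)) => n D st d1 input.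
have n1 := two_vertices d1.
case: n n1 D st d1 input => // n' n1 D st d1 input.
have w2ge := sum_w2_ge d1; have meange := mean_gain_ge D.
have sq2 : 0 <= Num.sqrt 2 :> R by exact: sqrtr_ge0.
have sqd : 0 < Num.sqrt (maxdeg D)%:R :> R by rewrite sqrtr_gt0 ltr0n.
set S := \sum_(v < n'.+1) w2 D v in w2ge meange *.
have degbound c : 0 <= c -> c * (2 * wsum D (arcs D) / Num.sqrt (maxdeg D)%:R) <= c * S.
  by move=> c0; rewrite ler_wpM2l.
exists (sigma D); split.
- move=> u u01; have o := is_ordering_sigma D (u01 0%N); split=> //; last exact: feedback_back.
  have [T [t [st' [e tT out]]] TN] := program_correct input (u01 0%N).
  exists t, st'; split=> //.
  have {}tT := leq_trans tT TN.
  have tR : t%:R <= (3000 * (#|arcs D| + n'.+2 * (nbits n').+1))%N%:R :> R.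
    by rewrite ler_nat.
  apply: le_trans tR _.
  have nb' : (nbits n').+1%:R <= 3 / ln 2 * ln n'.+1%:R :> R.
    by rewrite mulrAC ler_pdivlMr //; exact: nbits_le.
  have n2 : n'.+2%:R <= 2 * n'.+1%:R :> R by rewrite -natrM ler_nat; lia.
  rewrite natrM natrD natrM -mulrA; apply: ler_wpM2l; first exact: ler0n.
  have a0 : 0 <= #|arcs D|%:R :> R by exact: ler0n.
  have h1 : n'.+2%:R * (nbits n').+1%:R <= 2 * n'.+1%:R * (3 / ln 2 * ln n'.+1%:R) :> R.
    by apply: ler_pM => //; exact: ler0n.
  have c0 : 0 <= (ln 2)^-1 :> R by rewrite invr_ge0 ltW.
  have h2 : 0 <= (ln 2)^-1 * #|arcs D|%:R :> R by exact: mulr_ge0.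
  have h3 : 0 <= n'.+1%:R * ln n'.+1%:R :> R.
    by apply: mulr_ge0; [exact: ler0n | apply: ln_ge0; rewrite ler1n].
  move: h1 h2 h3 a0; move: (#|arcs D|%:R : R) (n'.+1%:R : R) (n'.+2%:R * _ : R) => a x z.
  move: (ln 2)^-1 (ln x) => c l; nra.
- move=> d Omega P U iidU; split.
  + move=> s; exact: measurable_sigma.
  + by rewrite expectation_gain // lee_fin.
  + rewrite expectation_back // lee_fin; lra.
- have := degbound (Num.sqrt 2 / 6) (divr_ge0 sq2 (ler0n _ _)).
  apply: le_trans; rewrite le_eqVlt; apply/orP; left; apply/eqP; field; lra.
- have := degbound (Num.sqrt 2 / 12) (divr_ge0 sq2 (ler0n _ _)).
  have -> : Num.sqrt 2 / 12 * (2 * wsum D (arcs D) / Num.sqrt (maxdeg D)%:R) =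
     Num.sqrt 2 / (6 * Num.sqrt (maxdeg D)%:R) * wsum D (arcs D) by field; lra.
  lra.
Qed.
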